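(* Let $K:\mathbb{R}^2\to[0,\infty)$ be measurable with $K(\zeta)=K(-\zeta)$ for a.e. $\zeta\in\mathbb{R}^2$, and suppose that there are constants $M_0\ge m_0>0$ and $R_0\ge r_0>0$ such that either $$m_0\,\chi_{B_{r_0}}(\zeta)\le K(\zeta)\le M_0\,\chi_{B_{R_0}}(\zeta)\quad\text{for all }\zeta\in\mathbb{R}^2,$$ or, for some $s\in(0,1)$, $$m_0\,\chi_{B_{r_0}}(\zeta)\le |\zeta|^{2+2s}K(\zeta)\le M_0\,\chi_{B_{R_0}}(\zeta)\quad\text{for all }\zeta\in\mathbb{R}^2\setminus\{0\}.$$ Let $\mathcal{L}$ be the operator with kernel $K$, let $f\in C^{1,\alpha}(\mathbb{R})$ for some $\alpha\in(0,1)$, and let $u\in C^1(\mathbb{R}^2)$, with $u$ and $\nabla u$ bounded on $\mathbb{R}^2$, be a solution of $\mathcal{L}u=f(u)$ in $\mathbb{R}^2$. Assume that $\partial_{x_2}u(x)>0$ for every $x\in\mathbb{R}^2$. Then $u$ is one-dimensional, i.e. there exist $u_\star:\mathbb{R}\to\mathbb{R}$ and $\omega\in\mathbb{R}^2$ such that $u(x)=u_\star(\omega\cdot x)$ for all $x\in\mathbb{R}^2$.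
   Context: $B_r$ is the open Euclidean ball of radius $r$ centered at the origin, $B_r(x)=x+B_r$, and $\chi_E$ is the characteristic function of $E$. The operator with kernel $K$ is $$\mathcal{L}u(x)=\int_{\mathbb{R}^2}\big(u(x)-u(y)\big)K(x-y)\,dy,$$ understood, when $K$ is not integrable, in the principal value sense $\lim_{r\to0}\int_{\mathbb{R}^2\setminus B_r(x)}\big(u(x)-u(y)\big)K(x-y)\,dy$. That $u$ is a solution of $\mathcal{L}u=f(u)$ in $\mathbb{R}^2$ means that $\mathcal{L}u(x)$ exists and equals $f(u(x))$ for every $x\in\mathbb{R}^2$. *)

(* Defs.v *)
From mathcomp Require Import all_boot all_order all_algebra.
From mathcomp Require Import all_classical all_reals all_analysis.

Set Implicit Arguments.
Unset Strict Implicit.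
Unset Printing Implicit Defensive.
Import Order.TTheory GRing.Theory Num.Theory.
Import numFieldNormedType.Exports.

Local Open Scope classical_set_scope.
Local Open Scope ring_scope.

(* The library norm on [R * R] is the sup norm, hence the Euclidean structure
   below. Both norms give the same topology and the same differentiability. *)
Definition dot {R : realType} (x y : R * R) : R := x.1 * y.1 + x.2 * y.2.

Definition enorm {R : realType} (x : R * R) : R := Num.sqrt (dot x x).

Definition eball {R : realType} (x : R * R) (r : R) : set (R * R) :=
  [set y | enorm (y - x) < r].

(* The product of two copies of [lebesgue_measure] lives on the Borel
   sigma-algebra of the plane; its completion is the Lebesgue measure on the
   sigma-algebra of all Lebesgue measurable sets, carried by [plane R], a copy
   of [R * R]. *)
Definition borel_lebesgue2 (R : realType) :
    {measure set (measurableTypeR R * measurableTypeR R)%type -> \bar R} :=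
  (@lebesgue_measure R \x @lebesgue_measure R)%E.

Definition plane (R : realType) : measurableType _ :=
  caratheodory_type (mu_ext (borel_lebesgue2 R)).

Definition lebesgue2 (R : realType) : {measure set (plane R) -> \bar R} :=
  @completed_measure_extension _ _ _ (borel_lebesgue2 R).

Definition lebesgue_measurable_fun {R : realType} (g : R * R -> R) : Prop :=
  measurable_fun [set: plane R] g.

Definition even_ae {R : realType} (K : R * R -> R) : Prop :=
  {ae lebesgue2 R, forall z : R * R, K z = K (- z)}.

Definition bounded_kernel {R : realType} (m0 M0 r0 R0 : R) (K : R * R -> R) :
    Prop :=
  forall z : R * R,
    m0 * \1_(eball 0 r0) z <= K z <= M0 * \1_(eball 0 R0) z.

Definition fractional_kernel {R : realType} (m0 M0 r0 R0 s : R)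
    (K : R * R -> R) : Prop :=
  forall z : R * R, z != 0 ->
    m0 * \1_(eball 0 r0) z <= enorm z `^ (2 + 2 * s) * K z
      <= M0 * \1_(eball 0 R0) z.

Definition nonlocal_integrand {R : realType} (K u : R * R -> R) (x : R * R)
    (y : R * R) : R :=
  (u x - u y) * K (x - y).

Definition integral_value {R : realType} (K u : R * R -> R) (x : R * R)
    (l : R) : Prop :=
  (lebesgue2 R).-integrable setT (EFin \o nonlocal_integrand K u x) /\
  (\int[lebesgue2 R]_y (nonlocal_integrand K u x y)%:E = l%:E)%E.

Definition principal_value {R : realType} (K u : R * R -> R) (x : R * R)
    (l : R) : Prop :=
  (forall r : R, 0 < r ->
    (lebesgue2 R).-integrable (~` eball x r)
      (EFin \o nonlocal_integrand K u x)) /\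
  (\int[lebesgue2 R]_(y in ~` eball x r) (nonlocal_integrand K u x y)%:E)%E
    @[r --> 0^'+] --> l%:E.

(* [nonlocal_value K u x l]: the operator with kernel [K], applied to [u],
   exists at [x] and equals [l]. *)
Definition nonlocal_value {R : realType} (K u : R * R -> R) (x : R * R)
    (l : R) : Prop :=
  if `[< (lebesgue2 R).-integrable setT (EFin \o K) >]
  then integral_value K u x l
  else principal_value K u x l.

Definition nonlocal_solution {R : realType} (K : R * R -> R) (f : R -> R)
    (u : R * R -> R) : Prop :=
  forall x : R * R, nonlocal_value K u x (f (u x)).

(* The Hoelder condition on the derivative is required on compact intervals
   only, with a constant depending on the interval, so that nonlinearities such
   as [t - t ^+ 3] are included. It entails the continuity of [derive1 f]. *)
Definition C1_hoelder {R : realType} (alpha : R) (f : R -> R) : Prop :=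
  (forall t : R, derivable f t 1) /\
  forall a b : R, exists C : R, forall t t' : R,
    t \in `[a, b] -> t' \in `[a, b] ->
    `|derive1 f t - derive1 f t'| <= C * `|t - t'| `^ alpha.

Definition partial1 {R : realType} (u : R * R -> R) (x : R * R) : R :=
  'D_((1, 0) : R * R) u x.

Definition partial2 {R : realType} (u : R * R -> R) (x : R * R) : R :=
  'D_((0, 1) : R * R) u x.

Definition gradient {R : realType} (u : R * R -> R) (x : R * R) : R * R :=
  (partial1 u x, partial2 u x).

Definition C1 {R : realType} (u : R * R -> R) : Prop :=
  (forall x : R * R, differentiable u x) /\ continuous (gradient u).

Definition one_dimensional {R : realType} (u : R * R -> R) : Prop :=
  exists (ustar : R -> R) (omega : R * R),
    forall x : R * R, u x = ustar (dot omega x).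

(* Main.v *)
Require Import Defs.
From HB Require Import structures.
From mathcomp Require Import all_boot all_order all_algebra.
From mathcomp Require Import all_classical all_reals all_analysis.
From mathcomp Require Import measurable_realfun ring lra.
Import Order.TTheory GRing.Theory Num.Theory.
Import numFieldNormedType.Exports.

Set Implicit Arguments.
Unset Strict Implicit.
Unset Printing Implicit Defensive.

Local Open Scope classical_set_scope.
Local Open Scope ring_scope.

(** Why the theorem is true. Formally, both partial derivatives of [u] solve the
    linear equation L g = f'(u) g, and phi = d_2 u is positive. It suffices to
    show that psi = d_1 u is a constant multiple c of phi, for then the gradient
    is everywhere proportional to (c, 1) and u depends only on c x_1 + x_2
    ([dot_one_dimensional]).

    As in the Liouville theorem behind De Giorgi's conjecture in the plane, the
    equations of psi and phi are combined and tested with a cut-off tau. Here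
    this bounds the energy of the wronskian,
      iint (psi(x) phi(x-z) - psi(x-z) phi(x))^2 tau(x)^2 K(z) dx dz
        <= C iint (tau(x) - tau(x-z))^2 K(z) dx dz.
    In dimension two there are cut-offs equal to N near a given point whose
    energy on the right is only O(N) ([cutoff], [form_cutoff]). Dividing by N^2
    and letting N tend to infinity, the wronskian vanishes wherever K(z) > 0 is
    guaranteed, so psi / phi is locally, hence globally, constant
    ([wronskian_eq0], [gradient_direction]).

    Two points need care. First, the derivatives of u need not satisfy any
    equation, so the argument is run with the difference quotients
    w = (u(x + h e_2) - u(x)) / h > 0 and b = (u(x + h e_1) - u(x)) / h, which
    do, with the quotients of f(u) as right-hand sides. There is no positive
    lower bound on w, so the natural test function tau^2 b / w is replaced by
    tau^2 b / (w + |b|), which is bounded. The wronskian still gains a square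
    ([energy_pointwise], [energy_bound]), and as h tends to zero the right-hand
    sides cancel in the limit ([wronskian_square_bound]).

    Secondly, the equation holds pointwise, with principal values that converge
    without any uniformity, whereas the test functions require its weak form.
    The inf-convolutions of u are semiconcave, so their truncated operators are
    bounded below, and at each point they inherit the equation of u at a nearby
    point as an inequality. This gives one inequality of the weak form in the
    limit; the other comes from - u ([weak_form_ge], [weak_form]).

    The kernel enters through three facts: it has bounded support, it is
    bounded below near the origin, and |z|^2 K(z) is integrable
    ([kernel_reduction]). It may be replaced by its even part ([symm]). *)

(** * Lebesgue measure on the plane *)

Lemma integral_measure_preserving d (T : measurableType d) (R : realType)
    (mu : {measure set T -> \bar R}) (phi : T -> T) (f : T -> \bar R) :
  measurable_fun setT phi ->
  (forall A, measurable A -> mu (phi @^-1` A) = mu A) ->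
  measurable_fun setT f ->
  (\int[mu]_x f (phi x) = \int[mu]_x f x)%E.
Proof.
move=> mphi inv mf.
have ge0 (g : T -> \bar R) : measurable_fun setT g -> (forall x, 0 <= g x)%E ->
    (\int[mu]_x g (phi x) = \int[mu]_x g x)%E.
  move=> mg g0; transitivity (\int[pushforward mu phi]_x g x)%E.
    by rewrite (ge0_integral_pushforward mphi).
  by apply: eq_measure_integral => A mA _; exact: inv.
have Ep := ge0 _ (measurable_funepos mf) (funepos_ge0 f).
have En := ge0 _ (measurable_funeneg mf) (funeneg_ge0 f).
rewrite [RHS]integralE -Ep -En [LHS]integralE.
by rewrite -[(fun x => f (phi x))]/(f \o phi) funepos_comp funeneg_comp.
Qed.

Section plane_measure.
Variable R : realType.
Let bplane : measurableType _ := (measurableTypeR R * measurableTypeR R)%type.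

(** An open set of the plane is a countable union of boxes with rational
    centres and radii 1/(n+1), and boxes are measurable rectangles. *)
Lemma open_borel2 (U : set (R * R)) : open U -> measurable (U : set bplane).
Proof.
move=> Uo.
pose box (a b : rat) (n : nat) : set bplane :=
  [set p | ball (ratr a : R) n.+1%:R^-1 p.1 /\ ball (ratr b : R) n.+1%:R^-1 p.2].
have mbox a b n : measurable (box a b n).
  rewrite (_ : box a b n = ball (ratr a : R) n.+1%:R^-1 `*` ball (ratr b : R) n.+1%:R^-1) //.
  by apply: measurableX; exact: measurable_ball.
rewrite (_ : (U : set bplane) = \bigcup_a \bigcup_b \bigcup_n
   (if `[< box a b n `<=` U >] then box a b n else set0)); last first.
  apply/seteqP; split; last first.
    by move=> p [a _] [b _] [n _]; case: asboolP => // bU /bU.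
  move=> [x y] Uxy.
  have /nbhs_ballP[e /= e0 eU] : nbhs ((x, y) : R * R) U by exact: open_nbhs_nbhs.
  have [n ne] : exists n : nat, n.+1%:R^-1 < e / 2.
    have [n _] := @near_infty_natSinv_lt R (PosNum (divr_gt0 e0 (@ltr0Sn R 1))).
    by move=> /(_ n) /(_ (leqnn _)) /= ?; exists n.
  have ratapp (t : R) : exists q : rat, `|ratr q - t| < n.+1%:R^-1.
    have : t - n.+1%:R^-1 < t + n.+1%:R^-1 by rewrite ltrD2l gtrN ?invr_gt0.
    by move=> /rat_in_itvoo[q]; rewrite in_itv /= -ltr_distl => qt; exists q.
  have aux (x' p' t : R) : `|t - x'| < n.+1%:R^-1 -> ball t n.+1%:R^-1 p' -> ball x' e p'.
    move=> tx tp; apply: (@ball_splitr _ _ t); apply: (le_ball (ltW ne)) => //.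
  have [a ha] := ratapp x; have [b hb] := ratapp y.
  exists a => //; exists b => //; exists n => //.
  case: asboolP => [_|]; first by split.
  case; move=> [p q] [/= hp hq]; apply: eU; split => /=.
    exact: (aux x p (ratr a)).
  exact: (aux y q (ratr b)).
apply: bigcupT_measurable_rat => a; apply: bigcupT_measurable_rat => b.
by apply: bigcupT_measurable => n; case: ifP.
Qed.

Lemma continuous_borel2 (f : R * R -> R) :
  continuous f -> measurable_fun [set: bplane] f.
Proof.
move=> cf; apply: (measurability _ (RGenOpens.measurableE R)).
move=> _ [_ [a [b ->]] <-]; rewrite setTI; apply: open_borel2.
by move/continuousP : cf; apply; exact: interval_open.
Qed.

Lemma borel2_plane (A : set (R * R)) :
  measurable (A : set bplane) -> measurable (A : set (plane R)).
Proof. by move=> mA; apply: sub_caratheodory; exact: sub_sigma_algebra. Qed.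

Lemma lebesgue2_borel (A : set (R * R)) : measurable (A : set bplane) ->
  lebesgue2 R A = borel_lebesgue2 R A.
Proof. by move=> mA; rewrite /lebesgue2 /= /completed_measure_extension measurable_mu_extE. Qed.

(** Completing a measure keeps it sigma-finite; for the product it suffices
    to square an exhaustion of the line. *)
Lemma sigma_finite_lebesgue2 : sigma_finite setT (lebesgue2 R).
Proof.
apply: completed_measure_extension_sigma_finite.
have /sigma_finiteP[F [FT ndF Foo]] := sigma_finiteT (@lebesgue_measure R).
exists (fun n => F n `*` F n).
  apply/esym/seteqP; split => // -[x y] _.
  have : (\bigcup_i F i) x by rewrite -FT.
  have : (\bigcup_i F i) y by rewrite -FT.
  move=> [n _ Fy] [k _ Fx]; exists (maxn n k) => //; split => /=.
    by move: x Fx; exact/subsetPset/ndF/leq_maxr.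
  by move: y Fy; exact/subsetPset/ndF/leq_maxl.
move=> k; have [mF Fk] := Foo k; split; first exact: measurableX.
by rewrite /borel_lebesgue2 /= product_measure1E// lte_mul_pinfty// ge0_fin_numE.
Qed.

Lemma measurable_plane_bplane : measurable_fun [set: plane R] (id : plane R -> bplane).
Proof. by move=> _ Y mY; rewrite setTI; apply: borel2_plane. Qed.

End plane_measure.

HB.instance Definition _ (R : realType) := Measure_isSigmaFinite.Build _ _ _
  (@completed_measure_extension _ _ _ (borel_lebesgue2 R)) (@sigma_finite_lebesgue2 R).

(** The measure [lebesgue2 R] once more, now with its sigma-finiteness
    attached to the type, which the theorems on iterated integrals require. *)
Definition lebesgue2_sf (R : realType) : {sigma_finite_measure set (plane R) -> \bar R} :=
  @completed_measure_extension _ _ _ (borel_lebesgue2 R).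

(** * Affine invariance of Lebesgue measure *)

Section affine_invariance.
Variable R : realType.
Let mR := measurableTypeR R.
Let bplane : measurableType _ := (measurableTypeR R * measurableTypeR R)%type.

Definition aff1 (s : bool) (a x : R) : R := a + (-1) ^+ s * x.

(** The maps x |-> a + x and x |-> a - x in one family: the sign bit selects
    the reflection. These are all the changes of variables that the proof
    uses. *)
Definition aff (s : bool) (a x : R * R) : R * R := (aff1 s a.1 x.1, aff1 s a.2 x.2).

Lemma measurable_aff1 s a : measurable_fun [set: mR] (aff1 s a : mR -> mR).
Proof.
apply: continuous_measurable_fun => x; apply: cvgD; first exact: cvg_cst.
by apply: cvgM; [exact: cvg_cst|exact: cvg_id].
Qed.

HB.instance Definition _ s a := @isMeasurableFun.Build _ _ mR mR (aff1 s a)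
  (measurable_aff1 s a).

Lemma lebesgue_aff1 s a (A : set R) : measurable A ->
  @lebesgue_measure R (aff1 s a @^-1` A) = @lebesgue_measure R A.
Proof.
move=> mA.
rewrite -[LHS]/(pushforward (@lebesgue_measure R) (aff1 s a : mR -> mR) A).
apply/esym/lebesgue_measure_unique => //; first exact: measurable_aff1.
move=> mf _ [[p q] _ <-].
rewrite /= /pushforward /=; case: s mf => mf /=.
  rewrite (_ : _ @^-1` _ = `[a - q, a - p[%classic).
    rewrite !lebesgue_measure_itv /= !lte_fin ltrD2l ltrN2.
    by case: ifP => // _; rewrite -!EFinB; congr (_%:E); lra.
  by apply/seteqP; split => x; rewrite /= /aff1 expr1 !in_itv /= => /andP[? ?]; apply/andP;
    split; lra.
rewrite (_ : _ @^-1` _ = `]p - a, q - a]%classic).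
  rewrite !lebesgue_measure_itv /= !lte_fin ltrD2r.
  by case: ifP => // _; rewrite -!EFinB; congr (_%:E); lra.
by apply/seteqP; split => x; rewrite /= /aff1 expr0 !in_itv /= => /andP[? ?]; apply/andP;
  split; lra.
Qed.

Lemma measurable_aff s a : measurable_fun [set: bplane] (aff s a : bplane -> bplane).
Proof.
apply/measurable_fun_pair; apply: measurableT_comp (measurable_aff1 _ _) _.
  exact: measurable_fst.
exact: measurable_snd.
Qed.

HB.instance Definition _ s a := @isMeasurableFun.Build _ _ bplane bplane (aff s a)
  (measurable_aff s a).

(** Both measures agree on rectangles, by the one-dimensional invariance,
    and a sigma-finite product measure is determined by its values there. *)
Lemma borel2_aff s a (A : set (R * R)) : measurable (A : set bplane) ->
  borel_lebesgue2 R (aff s a @^-1` A) = borel_lebesgue2 R A.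
Proof.
move=> mA; rewrite -[LHS]/(pushforward (borel_lebesgue2 R) (aff s a : bplane -> bplane) A).
apply/esym/product_measure_unique => //; first exact: measurable_aff.
move=> mf B C mB mC.
rewrite /pushforward /= -(lebesgue_aff1 s a.1 mB) -(lebesgue_aff1 s a.2 mC).
rewrite -product_measure1E //.
- by rewrite -[X in measurable X]setTI; exact: measurable_aff1.
- by rewrite -[X in measurable X]setTI; exact: measurable_aff1.
Qed.

Lemma aff1K s a : cancel (aff1 s a) (aff1 s (- ((-1) ^+ s * a))).
Proof. by move=> x; rewrite /aff1 mulrDr signrMK; ring. Qed.

Lemma affK s a : cancel (aff s a) (aff s (- ((-1) ^+ s * a.1), - ((-1) ^+ s * a.2))).
Proof. by case=> x y; rewrite /aff /= !aff1K. Qed.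

Lemma affVK s a : cancel (aff s (- ((-1) ^+ s * a.1), - ((-1) ^+ s * a.2))) (aff s a).
Proof.
case=> x y; rewrite /aff /=; congr (_, _); by rewrite /aff1 mulrDr mulrN !signrMK; ring.
Qed.

(** A countable Borel cover of [A] pulls back to a cover of the preimage
    with the same total measure. The reverse inequality follows by applying
    this to the inverse map, which belongs to the same family. *)
Lemma lebesgue2_aff_le s a (A : set (R * R)) :
  ((borel_lebesgue2 R)^* (aff s a @^-1` A) <= (borel_lebesgue2 R)^* A)%mu%E.
Proof.
rewrite /mu_ext; apply/le_ereal_inf_tmp => _ [B [mB AB] <-].
apply: ereal_inf_lbound; exists (fun n => aff s a @^-1` (B n)).
  split.
    by move=> n; rewrite -[X in measurable X]setTI; exact: measurable_aff.
  by move=> x /AB [n _ Bn]; exists n.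
by apply: eq_eseriesr => n _; rewrite borel2_aff.
Qed.

Lemma lebesgue2_aff s a (A : set (R * R)) : lebesgue2_sf R (aff s a @^-1` A) = lebesgue2_sf R A.
Proof.
apply/eqP; rewrite eq_le; apply/andP; split; first exact: lebesgue2_aff_le.
set b := (- ((-1) ^+ s * a.1), - ((-1) ^+ s * a.2)).
rewrite [X in (lebesgue2_sf R X <= _)%E](_ : A = aff s b @^-1` (aff s a @^-1` A)); last first.
  by apply/seteqP; split => x /=; rewrite affVK.
exact: lebesgue2_aff_le.
Qed.

(** Borel measurability is not enough here: a preimage of a Lebesgue
    measurable set is measurable because the map preserves the outer measure
    of every set, so that the Caratheodory criterion can be transported. *)
Lemma measurable_plane_aff s a : measurable_fun [set: plane R] (aff s a : plane R -> plane R).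
Proof.
move=> _ A mA; rewrite setTI; rewrite /measurable /= in mA *; move=> X.
set b := (- ((-1) ^+ s * a.1), - ((-1) ^+ s * a.2)).
have E Y : (Y = aff s a @^-1` (aff s b @^-1` Y)).
  by apply/seteqP; split => x /=; rewrite affK.
have := mA (aff s b @^-1` X).
have M Y : ((@lebesgue_measure R \x @lebesgue_measure R)%E)^*%mu (aff s a @^-1` Y) =
   ((@lebesgue_measure R \x @lebesgue_measure R)%E)^*%mu Y by exact: lebesgue2_aff.
rewrite -(M (aff s b @^-1` X)) -(M (aff s b @^-1` X `&` A)) -(M (aff s b @^-1` X `&` ~` A)).
by rewrite !preimage_setI -!E preimage_setC.
Qed.

Lemma integral_aff s a (f : R * R -> \bar R) : measurable_fun [set: plane R] f ->
  (\int[lebesgue2_sf R]_x f (aff s a x) = \int[lebesgue2_sf R]_x f x)%E.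
Proof.
exact: (integral_measure_preserving (measurable_plane_aff s a) (fun A _ => lebesgue2_aff s
  a A)).
Qed.

Lemma box_borel2 (a b c d : R) : measurable ((`]a, b[ `*` `]c, d[) : set bplane).
Proof. by apply: measurableX; exact: measurable_itv. Qed.

Lemma lebesgue2_box (a b c d : R) : a <= b -> c <= d ->
  lebesgue2_sf R (`]a, b[%classic `*` `]c, d[%classic) = ((b - a) * (d - c))%:E.
Proof.
move=> ab cd; rewrite -[LHS]/(lebesgue2 R _) lebesgue2_borel; last exact: box_borel2.
rewrite [LHS]product_measure1E; [|exact: measurable_itv..].
rewrite /= !lebesgue_measure_itv /= !lte_fin EFinM -!EFinB.
have aux (x y : R) : x <= y -> (if x < y then (y - x)%:E else 0%E) = (y - x)%:E.
  by rewrite le_eqVlt => /predU1P[->|->//]; rewrite ltxx subrr.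
by rewrite !aux.
Qed.
End affine_invariance.

(** * Sup norm, Euclidean norm and Lipschitz functions *)

Section plane_norm.
Variable R : realType.
Implicit Types x y z : R * R.

Lemma norm1_le x : `|x.1| <= `|x|. Proof. by rewrite prod_normE le_max lexx. Qed.
Lemma norm2_le x : `|x.2| <= `|x|. Proof. by rewrite prod_normE le_max lexx orbT. Qed.
Lemma norm_prod_lt x r : (`|x| < r) = (`|x.1| < r) && (`|x.2| < r).
Proof. by rewrite prod_normE gt_max. Qed.
Lemma sqr_norm_le_dot x : `|x| ^+ 2 <= dot x x.
Proof.
rewrite /dot -!expr2 prod_normE; case: (leP `|x.1| `|x.2|) => _;
  rewrite -normrX ger0_norm ?sqr_ge0 //.
  by rewrite lerDr sqr_ge0.
by rewrite lerDl sqr_ge0.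
Qed.
Lemma dot_ge0 x : 0 <= dot x x. Proof. by rewrite /dot -!expr2 addr_ge0 ?sqr_ge0. Qed.
Lemma dot_eq0 x : dot x x = 0 -> x = 0.
Proof.
case: x => a b /eqP; rewrite /dot /= -!expr2 paddr_eq0 ?sqr_ge0 // !sqrf_eq0.
by move=> /andP[/eqP -> /eqP ->].
Qed.
Lemma dotN x : dot (- x) (- x) = dot x x. Proof. by rewrite /dot /= !mulrNN. Qed.
Lemma norm_le_enorm x : `|x| <= enorm x.
Proof.
by rewrite -[`|x|]normr_id -sqrtr_sqr /enorm ler_wsqrtr // sqr_norm_le_dot.
Qed.
Lemma sqr_enorm x : enorm x ^+ 2 = dot x x.
Proof. by rewrite sqr_sqrtr ?dot_ge0. Qed.
Lemma enormN x : enorm (- x) = enorm x.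
Proof. by rewrite /enorm dotN. Qed.

Lemma affE s (a x : R * R) : aff s a x = a + (-1) ^+ s *: x.
Proof. by []. Qed.
Lemma aff_shift a x : aff false a x = a + x.
Proof. by rewrite affE expr0 scale1r. Qed.
Lemma aff_opp x : aff true 0 x = - x.
Proof. by rewrite affE expr1 scaleN1r add0r. Qed.
Lemma aff_sub a x : aff true a x = a - x.
Proof. by rewrite affE expr1 scaleN1r. Qed.

(** Relative to the sup norm of [R * R]. *)
Definition lipschitz_with (L : R) (u : R * R -> R) := forall x y, `|u x - u y| <= L * `|x - y|.

Lemma lipschitz_continuous L u : lipschitz_with L u -> continuous u.
Proof.
move=> Lu x; apply/cvgrPdist_lt => e e0.
have L0 : 0 < `|L| + 1 by rewrite ltr_wpDl.
near=> y; apply: le_lt_trans (Lu _ _) _.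
apply: (@le_lt_trans _ _ ((`|L| + 1) * `|x - y|)).
  by rewrite ler_wpM2r // (le_trans (ler_norm L)) // lerDl.
rewrite -ltr_pdivlMl //; near: y.
by apply: cvgr_dist_lt; [exact: cvg_id|rewrite mulr_gt0 // invr_gt0].
Unshelve. all: by end_near. Qed.

Lemma continuous_dot : continuous (fun x => dot x x).
Proof.
move=> x; apply: cvgD; apply: cvgM; (try exact: cvg_fst); exact: cvg_snd.
Qed.

Lemma continuous_enorm : continuous (@enorm R).
Proof. by move=> x; apply: continuous_comp; [exact: continuous_dot|exact: sqrt_continuous]. Qed.

End plane_norm.

(** * Inf-convolution *)

Section infconv.
Variable R : realType.
Variables (u : R * R -> R) (C L m : R).
Hypotheses (m0 : 0 < m) (L0 : 0 <= L) (uC : forall x, `|u x| <= C) (uL : lipschitz_with L u).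
Implicit Types x y z : R * R.

Let q y := dot y y.

(** For [q y] the squared Euclidean norm, the infimum over y of u y + m q (x
    - y) is attained: since u is bounded, only a fixed square around x
    matters, and that square is compact. *)
Lemma infconv_attained x : exists y, forall y', u y + m * q (x - y) <= u y' + m * q (x - y').
Proof.
have C0 : 0 <= C := le_trans (normr_ge0 _) (uC 0).
(* Outside the square of half-side r the penalty m |x - y|^2 exceeds the total
   oscillation 2 C of u; the summand 1 ensures r <= r^2. *)
pose r := 1 + 2 * C / m.
pose B : set (R * R) := `[x.1 - r, x.1 + r]%classic `*` `[x.2 - r, x.2 + r]%classic.
have cB : compact B by apply: compact_setX; exact: segment_compact.
pose F y := u y + m * q (x - y).
have cF : continuous F.
  move=> y; apply: cvgD; first exact: (lipschitz_continuous uL).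
  apply: cvgM; first exact: cvg_cst.
  apply: (@continuous_comp _ _ _ (fun y => x - y) q); last exact: continuous_dot.
  by apply: cvgB; [exact: cvg_cst|exact: cvg_id].
have Cm : 0 <= C / m by rewrite divr_ge0 // ltW.
have r1 : 1 <= r by rewrite /r -mulrA; lra.
have Bx : B x by split; rewrite /= in_itv /=; lra.
have [|c /set_mem Bc cmin] := @compact_EVT_min _ _ F B (ex_intro _ x Bx) cB.
  exact: continuous_subspaceT.
exists c => y; have [/mem_set By|nBy] := pselect (B y); first exact: cmin.
apply: (le_trans (cmin _ (mem_set Bx))).
rewrite /F /q subrr /dot /= !mul0r addr0 mulr0 addr0.
have h : r <= `|x - y|.
  rewrite leNgt norm_prod_lt; apply/negP => /andP[];
    rewrite /= !ltr_norml => /andP[? ?] /andP[? ?].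
  by apply: nBy; split; rewrite /= in_itv /=; lra.
have h2 : r <= dot (x - y) (x - y).
  by apply: le_trans (sqr_norm_le_dot _); rewrite expr2; apply: (le_trans h);
    rewrite ler_peMr // (le_trans _ h).
have h3 : 2 * C <= m * dot (x - y) (x - y).
  apply: (@le_trans _ _ (m * r)); last by rewrite ler_pM2l.
  by have -> : m * r = m + 2 * C; [rewrite /r; field; rewrite gt_eqF|rewrite lerDr ltW].
have := uC x; have := uC y; rewrite !ler_norml /dot /= in h3 * => /andP[? ?] /andP[? ?]; lra.
Qed.

Definition infconv_pt x := sval (cid (infconv_attained x)).
Definition infconv x := u (infconv_pt x) + m * q (x - infconv_pt x).

Lemma infconv_le x y : infconv x <= u y + m * q (x - y).
Proof. exact: (svalP (cid (infconv_attained x))). Qed.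

Lemma infconv_le_u x : infconv x <= u x.
Proof. by rewrite (le_trans (infconv_le x x)) // /q subrr /dot /= !mul0r addr0 mulr0 addr0. Qed.

Lemma infconv_pt_near x : `|x - infconv_pt x| <= L / m.
Proof.
set y := infconv_pt x; have := infconv_le_u x; rewrite /infconv -/y => h.
have h1 : m * `|x - y| ^+ 2 <= L * `|x - y|.
  apply: (@le_trans _ _ (m * q (x - y))); first by rewrite ler_pM2l // sqr_norm_le_dot.
  apply: (@le_trans _ _ (u x - u y)); first lra.
  exact: le_trans (ler_norm _) (uL _ _).
have [->|n0] := eqVneq `|x - y| 0; first by rewrite divr_ge0 // ltW.
have p0 : 0 < `|x - y| by rewrite lt_def n0 normr_ge0.
rewrite ler_pdivlMr //; move: h1; rewrite expr2 mulrA ler_pM2r //; by rewrite mulrC.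
Qed.

Lemma infconv_ge x : u x - L ^+ 2 / m <= infconv x.
Proof.
set y := infconv_pt x.
have h : u x - u y <= L * (L / m).
  by rewrite (le_trans (ler_norm _)) // (le_trans (uL _ _)) // ler_wpM2l // infconv_pt_near.
have h2 : 0 <= m * q (x - y) by rewrite mulr_ge0 ?dot_ge0 // ltW.
by rewrite /infconv -/y expr2 -mulrA; lra.
Qed.

Lemma infconv_bounded x : `|infconv x| <= C.
Proof.
have := uC x; have := uC (infconv_pt x); rewrite !ler_norml => /andP[h1 h2] /andP[h3 h4].
have h5 := infconv_le_u x.
have h6 : 0 <= m * q (x - infconv_pt x) by rewrite mulr_ge0 ?dot_ge0 // ltW.
by apply/andP; split; last lra; rewrite /infconv; lra.
Qed.

(** If y realizes the infimum at x, then u, shifted by x - y and raised by a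
    constant, touches the inf-convolution from above at x. Increments of the
    inf-convolution at x therefore dominate those of u at y, which makes the
    inf-convolution a supersolution up to the displacement of y. *)
Lemma infconv_touch x z : u (infconv_pt x) - u (infconv_pt x - z) <= infconv x - infconv (x
  - z).
Proof.
have := infconv_le (x - z) (infconv_pt x - z).
rewrite [x - z - _](_ : _ = x - infconv_pt x); last by rewrite opprB addrA subrK.
have -> : infconv x = u (infconv_pt x) + m * q (x - infconv_pt x) by [].
by move=> ?; lra.
Qed.

Lemma infconv_lipschitz : lipschitz_with L infconv.
Proof.
have aux x x' : infconv x - infconv x' <= L * `|x - x'|.
  have := infconv_touch x' (x' - x); rewrite subKr => h.
  have := uL (infconv_pt x') (infconv_pt x' - (x' - x)); rewrite subKr => h2.
  have := ler_norm (u (infconv_pt x' - (x' - x)) - u (infconv_pt x')).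
  rewrite distrC => h3; rewrite distrC; lra.
move=> x y; rewrite ler_norml aux andbT.
by have := aux y x; rewrite distrC; lra.
Qed.

(** Use the minimizer at x as a competitor at x + z and at x - z; the second
    difference of a square is exact. *)
Lemma infconv_semiconcave x z : infconv (x + z) + infconv (x - z) - 2 * infconv x <= 2 * m
  * dot z z.
Proof.
set y := infconv_pt x.
have h1 := infconv_le (x + z) y; have h2 := infconv_le (x - z) y.
rewrite {3}/infconv -/y; apply: (@le_trans _ _ (m * (q (x + z - y) + q (x - z - y) - 2 * q
  (x - y)))).
  lra.
by rewrite /q /dot /= le_eqVlt; apply/orP; left; apply/eqP; ring.
Qed.

End infconv.

(** * Logarithmic cut-offs *)

Section cutoff.
Variable R : realType.
Implicit Types (x y z : R * R) (r : R).

Definition bump r x : R := Num.max 0 (Num.min 1 (2 - `|x| / r)).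

Lemma bump_itv r x : 0 <= bump r x <= 1.
Proof. by rewrite /bump le_max lexx /= ge_max ler01 /= ge_min lexx. Qed.

Lemma bump1 r x : 0 < r -> `|x| <= r -> bump r x = 1.
Proof.
move=> r0 xr; rewrite /bump min_l ?max_r //.
have : `|x| / r <= 1 by rewrite ler_pdivrMr // mul1r.
by set t := _ / _; lra.
Qed.

Lemma bump0 r x : 0 < r -> 2 * r <= `|x| -> bump r x = 0.
Proof.
move=> r0 xr; have h : 2 <= `|x| / r by rewrite ler_pdivlMr.
by rewrite /bump max_l // ge_min; apply/orP; right; move: h; set t := _ / _; lra.
Qed.

Lemma bump_lipschitz r : 0 < r -> lipschitz_with r^-1 (bump r).
Proof.
move=> r0 x y.
have clamp (a b : R) : `|Num.max 0 (Num.min 1 a) - Num.max 0 (Num.min 1 b)| <= `|a - b|.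
  case: (leP 1 a) => ha; case: (leP 1 b) => hb; rewrite ?(max_r ler01);
  try (case: (leP 0 a) => ha'); try (case: (leP 0 b) => hb'); rewrite ler_norml;
  have := ler_norm (a - b); have := ler_norm (b - a); rewrite (distrC b); lra.
apply: (le_trans (clamp _ _)).
rewrite [X in `|X|](_ : _ = r^-1 * (`|y| - `|x|)); last by ring.
rewrite normrM ger0_norm ?invr_ge0 ?(ltW r0) // distrC.
by apply: ler_wpM2l; [rewrite invr_ge0 ltW|exact: ler_dist_dist].
Qed.

End cutoff.

Section cutoff_sum.
Variable R : realType.
Implicit Types (x y z : R * R).
Variables (rho R0 : R).
Hypotheses (R0_gt0 : 0 < R0) (rho_ge : R0 <= rho).

Let rho0 : 0 < rho := lt_le_trans R0_gt0 rho_ge.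
Definition scale k : R := rho * 4 ^+ k.
Let s0 k : 0 < scale k. Proof. by rewrite mulr_gt0 // exprn_gt0. Qed.
Let sS k : scale k.+1 = 4 * scale k. Proof. by rewrite /scale exprS mulrCA. Qed.
Let s_ge k : rho <= scale k.
Proof. by rewrite /scale ler_peMr ?(ltW rho0) // exprn_ege1 // ler1n. Qed.

(** The sum of N bumps at the scales rho 4^k. The bumps vary in disjoint
    annuli, each with energy of order one because the plane is
    two-dimensional: the squared gradient is of order 1/scale^2 on an area
    of order scale^2. The height is N and the total energy is only of order
    N, a discrete form of the logarithmic cut-off. *)
Definition cutoff N x : R := \sum_(k < N) bump (scale k) x.

Lemma cutoffS N x : cutoff N.+1 x = cutoff N x + bump (scale N) x.
Proof. by rewrite /cutoff big_ord_recr. Qed.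

Lemma cutoff_itv N x : 0 <= cutoff N x <= N%:R.
Proof.
elim: N => [|N]; first by rewrite /cutoff big_ord0 lexx.
rewrite cutoffS -natr1 => /andP[? ?]; have /andP[? ?] := bump_itv (scale N) x.
by apply/andP; split; lra.
Qed.

Lemma cutoff_center N x : `|x| <= rho -> cutoff N x = N%:R.
Proof.
move=> xr; elim: N => [|N IH]; first by rewrite /cutoff big_ord0.
by rewrite cutoffS IH bump1 ?natr1 ?s0 // (le_trans xr) // s_ge.
Qed.

Lemma cutoff_out N x : scale N <= 2 * `|x| -> cutoff N x = 0.
Proof.
elim: N => [|N IH]; first by rewrite /cutoff big_ord0.
rewrite sS cutoffS => h; have := s0 N => ?; rewrite IH ?add0r; last by lra.
by apply: bump0 => //; lra.
Qed.

Lemma cutoff_lipschitz N : lipschitz_with (\sum_(k < N) (scale k)^-1) (cutoff N).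
Proof.
move=> x y; elim: N => [|N IH].
  by rewrite /cutoff !big_ord0 subrr normr0 mul0r.
rewrite !cutoffS big_ord_recr /= mulrDl opprD addrACA (le_trans (ler_normD _ _)) //.
by rewrite lerD // bump_lipschitz.
Qed.

(** As |z| < R0 <= rho is small compared with all scales, x and x - z never
    see two bumps vary at once, so the cross terms of the square vanish. *)
Lemma cutoff_energy N x z : `|z| < R0 ->
  (cutoff N x - cutoff N (x - z)) ^+ 2 <=
  \sum_(k < N) ((scale k) ^- 2 * \1_[set y | `|y| < 4 * scale k] x) * dot z z.
Proof.
move=> zR; elim: N => [|N IH].
  by rewrite /cutoff !big_ord0 subrr expr0n.
rewrite !cutoffS big_ord_recr /= opprD addrACA.
set a := cutoff N x - _; set b := bump _ _ - _.
have tri : `|x| <= `|x - z| + `|z| by rewrite -{1}(subrK z x) ler_normD.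
have tri' : `|x - z| <= `|x| + `|z| by rewrite ler_normB.
(* The first N bumps are constant (equal to 0) beyond half of [scale N], the
   new bump is constant (equal to 1) up to [scale N], and |z| is too small to
   bridge the gap. *)
have ab0 : a * b = 0.
  have [xs|xs] := leP `|x| (scale N); have [ys|ys] := leP `|x - z| (scale N).
  - by rewrite /b !bump1 // subrr mulr0.
  - have -> : a = 0; last by rewrite mul0r.
    case: (N) (s_ge N) (s0 N) @a ys xs => [|n] h1 h2 /= ys xs;
      first by rewrite /cutoff !big_ord0 subrr.
    by rewrite !cutoff_out ?subrr //; have := s_ge n; have := sS n; have := R0_gt0;
      move: xs ys tri tri' zR rho_ge; set p := `|x|; set q := `|x - z|; set t := `|z|; lra.
  - have -> : a = 0; last by rewrite mul0r.
    case: (N) (s_ge N) (s0 N) @a ys xs => [|n] h1 h2 /= ys xs;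
      first by rewrite /cutoff !big_ord0 subrr.
    by rewrite !cutoff_out ?subrr //; have := s_ge n; have := sS n; have := R0_gt0;
      move: xs ys tri tri' zR rho_ge; set p := `|x|; set q := `|x - z|; set t := `|z|; lra.
  - by rewrite /a !cutoff_out ?subrr ?mul0r //; have := s0 N;
      move: xs ys; set p := `|x|; set q := `|x - z|; lra.
have -> : (a + b) ^+ 2 = a ^+ 2 + b ^+ 2 by rewrite sqrrD ab0 mul0rn addr0.
rewrite lerD //.
have [xr|xr] := ltP `|x| (4 * scale N); last first.
  have -> : b = 0.
    rewrite /b !bump0 ?subrr //; have := s_ge N; have := R0_gt0; have := rho_ge;
      move: xr zR tri.
    by set p := `|x|; set q := `|x - z|; set t := `|z|; lra.
    by have := s0 N; set p := `|x|; lra.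
  by rewrite expr0n mulr_ge0 ?dot_ge0 // mulr_ge0 ?invr_ge0 ?sqr_ge0 // indicE ler0n.
rewrite indicE mem_set // mulr1.
apply: (@le_trans _ _ (((scale N)^-1 * `|z|) ^+ 2)); last first.
  by rewrite exprMn exprVn ler_wpM2l ?invr_ge0 ?sqr_ge0 // sqr_norm_le_dot.
rewrite -(@real_normK _ b) ?num_real // lerXn2r ?nnegrE // ?mulr_ge0 ?invr_ge0 ?(ltW (s0 _)) //.
by have := bump_lipschitz (s0 N) x (x - z); rewrite subKr.
Qed.

End cutoff_sum.

(** * Lipschitz bounds for the test functions *)

Section lipschitz_algebra.
Variable R : realType.
Implicit Types (u v : R * R -> R).

Lemma lipschitzM L1 L2 C1 C2 u v : (forall x, `|u x| <= C1) -> (forall x, `|v x| <= C2) ->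
  lipschitz_with L1 u -> lipschitz_with L2 v ->
    lipschitz_with (L1 * C2 + C1 * L2) (fun x => u x * v x).
Proof.
move=> uC vC uL vL x y.
have -> : u x * v x - u y * v y = (u x - u y) * v x + u y * (v x - v y) by ring.
rewrite (le_trans (ler_normD _ _)) // !normrM.
rewrite [leRHS](_ : _ = L1 * `|x - y| * C2 + C1 * (L2 * `|x - y|)); last by ring.
by apply: lerD; apply: ler_pM.
Qed.

Lemma lipschitzD L1 L2 u v : lipschitz_with L1 u -> lipschitz_with L2 v ->
  lipschitz_with (L1 + L2) (fun x => u x + v x).
Proof.
move=> uL vL x y; rewrite opprD addrACA (le_trans (ler_normD _ _)) // mulrDl lerD //.
Qed.

Lemma lipschitzN L u : lipschitz_with L u -> lipschitz_with L (fun x => - u x).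
Proof. by move=> uL x y; rewrite -opprD normrN. Qed.

Lemma lipschitz_norm L u : lipschitz_with L u -> lipschitz_with L (fun x => `|u x|).
Proof. by move=> uL x y; rewrite (le_trans (ler_dist_dist _ _)). Qed.

Lemma lipschitz_max0 L u : 0 <= L -> lipschitz_with L u ->
  lipschitz_with L (fun x => Num.max (u x) 0).
Proof.
move=> L0 uL x y; apply: le_trans (uL x y); case: (leP (u x) 0) => hx;
  case: (leP (u y) 0) => hy;
  have := ler_norm (u x - u y); have := ler_norm (u y - u x);
    rewrite ?(distrC (u y)) ler_norml; lra.
Qed.

(** For b >= 0 this is half the harmonic mean of a and b. The test function
    is a quotient b / (a + |b|), which is not Lipschitz with a uniform
    constant where a and b are both small; its products with a and with b
    are, and only those enter the weak formulation. *)
Definition harm (a b : R) := a * b / (a + `|b|).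

Lemma harm_le (a b : R) : 0 < a -> `|harm a b| <= `|b|.
Proof.
move=> a0; rewrite /harm normrM normfV (ger0_norm (addr_ge0 (ltW a0) (normr_ge0 b))).
rewrite ler_pdivrMr ?ltr_pwDl // normrM (gtr0_norm a0) mulrC ler_wpM2l // lerDl //.
Qed.

Let harm_mono (a a' b b' : R) : 0 < a -> 0 < a' -> 0 <= b -> 0 <= b' ->
  `|harm a b - harm a' b'| <= `|a - a'| + `|b - b'|.
Proof.
move=> a0 a0' b0 b0'; rewrite /harm (ger0_norm b0) (ger0_norm b0').
have p1 : 0 < a + b by lra.
have p2 : 0 < a' + b by lra.
have p3 : 0 < a' + b' by lra.
have -> : a * b / (a + b) - a' * b' / (a' + b') =
   b / (a + b) * (b / (a' + b)) * (a - a') + a' / (a' + b) * (a' / (a' + b')) * (b - b').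
  by field; rewrite !gt_eqF.
have fr (s t : R) : 0 <= s -> 0 <= t -> 0 < s + t -> 0 <= s / (s + t) <= 1.
  move=> s1 t1 st; apply/andP; split; first by rewrite divr_ge0 // ltW.
  by rewrite ler_pdivrMr // mul1r lerDl.
have frM (s t e : R) : 0 <= s <= 1 -> 0 <= t <= 1 -> `|s * t * e| <= `|e|.
  move=> /andP[? ?] /andP[? ?]; rewrite normrM ler_piMl // ger0_norm ?mulr_ge0 //.
  by rewrite mulr_ile1.
rewrite (le_trans (ler_normD _ _)) // lerD // frM //.
- by rewrite [a + b]addrC; apply: fr => //; [exact: ltW|rewrite addrC].
- by rewrite [a' + b]addrC; apply: fr => //; [exact: ltW|rewrite addrC].
- by apply: fr => //; exact: ltW.
- by apply: fr => //; exact: ltW.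
Qed.

(** For b >= 0 the increment is a combination of those of a and b with
    coefficients in [0, 1]; a general b is split into its positive and
    negative parts. *)
Lemma harm_lipschitz (a a' b b' : R) : 0 < a -> 0 < a' ->
  `|harm a b - harm a' b'| <= 2 * (`|a - a'| + `|b - b'|).
Proof.
move=> a0 a0'.
have E (s t : R) : harm s t = harm s (Num.max t 0) - harm s (Num.max (- t) 0).
  case: (leP t 0) => t0.
    by rewrite max_l ?oppr_ge0 // /harm mulr0 mul0r sub0r normrN mulrN mulNr opprK.
  by rewrite max_r ?oppr_le0 ?ltW // /harm mulr0 mul0r subr0.
have mx (t : R) : 0 <= Num.max t 0 by rewrite le_max lexx orbT.
have mm (s t : R) : `|Num.max s 0 - Num.max t 0| <= `|s - t|.
  case: (leP s 0) => hx; case: (leP t 0) => hy;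
  have := ler_norm (s - t); have := ler_norm (t - s); rewrite ?(distrC t) ler_norml; lra.
have -> : harm a b - harm a' b' = (harm a (Num.max b 0) - harm a' (Num.max b' 0)) -
    (harm a (Num.max (- b) 0) - harm a' (Num.max (- b') 0)) by rewrite (E a b) (E a' b'); ring.
rewrite (le_trans (ler_normB _ _)) // mulr2n mulrDl mul1r lerD //.
  by rewrite (le_trans (harm_mono a0 a0' (mx _) (mx _))) // lerD2l.
rewrite (le_trans (harm_mono a0 a0' (mx _) (mx _))) // lerD2l (le_trans (mm _ _)) //.
by rewrite -opprD normrN.
Qed.

End lipschitz_algebra.

(** * The pointwise energy inequality *)

(** The algebraic heart of the energy estimate. Let q be the wronskian of
    (b, w) at two points, and tau a cut-off with values tx and ty. Without
    the cut-off, q times the difference of the quotients b / (w + |b|) is at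
    least q^2 divided by the product of the two denominators. The cut-off
    produces an error term linear in tx - ty, which Young's inequality
    absorbs into the main term at the price of (tx - ty)^2. The upper bound
    B for the denominators removes them from the final estimate. *)
Lemma energy_pointwise (R : realFieldType) (B wx wy bx by' tx ty : R) :
  0 < wx -> 0 < wy -> 0 <= tx -> 0 <= ty -> wx + `|bx| <= B -> wy + `|by'| <= B ->
  (bx * wy - by' * wx) ^+ 2 * tx ^+ 2 <=
  4 * B ^+ 2 * ((bx * wy - by' * wx) * (tx ^+ 2 * (bx / (wx + `|bx|)) - ty ^+ 2 * (by' /
    (wy + `|by'|))))
  + 8 * B ^+ 4 * (tx - ty) ^+ 2.
Proof.
move=> wx0 wy0 tx0 ty0 pxB pyB; set q := bx * wy - _.
set px := wx + `|bx| in pxB *; set py := wy + `|by'| in pyB *.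
have px0 : 0 < px by rewrite ltr_pwDl.
have py0 : 0 < py by rewrite ltr_pwDl.
pose pp := px * py; have pp0 : 0 < pp by rewrite mulr_gt0.
have ppB : pp <= B ^+ 2 by rewrite expr2 ler_pM // ltW.
pose a := bx * py; pose b := by' * px; pose S := tx ^+ 2 + ty ^+ 2.
set d := tx - ty; pose sm := tx + ty.
have S0 : 0 <= S by rewrite addr_ge0 // sqr_ge0.
have aP : `|a| <= pp by rewrite /a normrM (gtr0_norm py0) ler_pM2r // lerDr ltW.
have bP : `|b| <= pp by rewrite /b normrM (gtr0_norm px0) mulrC ler_pM2l // lerDr ltW.
(* a - b is q plus a term of the same sign as q, which vanishes when bx and
   by' have the same sign. *)
have qab : q ^+ 2 <= q * (a - b).
  have -> : a - b = q + (bx * `|by'| - by' * `|bx|) by rewrite /a /b /q /px /py; ring.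
  rewrite mulrDr -expr2 lerDl /q.
  case: (lerP 0 bx) => hx; case: (lerP 0 by') => hy.
  - by rewrite !ger0_norm // (mulrC by' bx) subrr mulr0.
  - rewrite (ger0_norm hx) (ltr0_norm hy).
    have h1 : 0 <= bx * wy by rewrite mulr_ge0 // ltW.
    have h2 : 0 <= - by' * wx by rewrite mulr_ge0 ?oppr_ge0 // ltW.
    have h3 : 0 <= bx * - by' by rewrite mulr_ge0 ?oppr_ge0 // ltW.
    by apply: mulr_ge0; lra.
  - rewrite (ltr0_norm hx) (ger0_norm hy).
    have h1 : 0 <= - bx * wy by rewrite mulr_ge0 ?oppr_ge0 // ltW.
    have h2 : 0 <= by' * wx by rewrite mulr_ge0 // ltW.
    have h3 : 0 <= - bx * by' by rewrite mulr_ge0 ?oppr_ge0 // ltW.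
    by rewrite -mulrNN; apply: mulr_ge0; lra.
  - by rewrite !ltr0_norm // !mulrN (mulrC by' bx) subrr mulr0.
have main : q ^+ 2 * S <= 4 * (q * (tx ^+ 2 * a - ty ^+ 2 * b)) + 8 * pp ^+ 2 * d ^+ 2.
  have E : q * (tx ^+ 2 * a - ty ^+ 2 * b) = (q * (a - b) * S + q * (a + b) * (d * sm)) / 2.
    by rewrite /S /d /sm; field.
  have h1 : q ^+ 2 * S <= q * (a - b) * S by rewrite ler_wpM2r.
  have h2 : - (2 * pp * (`|q| * `|d| * sm)) <= q * (a + b) * (d * sm).
    rewrite lerNl -normrN; apply: le_trans (ler_norm _) _; rewrite !normrN !normrM.
    have sm0 : 0 <= sm by rewrite addr_ge0.
    rewrite (ger0_norm sm0) [leRHS](_ : _ = `|q| * (2 * pp) * (`|d| * sm)); last by ring.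
    apply: ler_wpM2r; first by rewrite mulr_ge0.
    apply: ler_wpM2l => //; apply: le_trans (ler_normD _ _) _; lra.
  have h3 : sm ^+ 2 <= 2 * S.
    by have := sqr_ge0 d; rewrite /sm /S /d !expr2; lra.
  (* Young's inequality, with the weight for which the main term absorbs the
     one in q^2. *)
  have h4 := sqr_ge0 (`|q| * sm - 4 * pp * `|d|).
  have h5 : `|q| ^+ 2 = q ^+ 2 by rewrite real_normK ?num_real.
  have h6 : `|d| ^+ 2 = d ^+ 2 by rewrite real_normK ?num_real.
  have h7 : q ^+ 2 * sm ^+ 2 <= q ^+ 2 * (2 * S) by rewrite ler_wpM2l ?sqr_ge0.
  have h8 : (`|q| * sm - 4 * pp * `|d|) ^+ 2 =
    q ^+ 2 * sm ^+ 2 - 8 * pp * (`|q| * `|d| * sm) + 16 * pp ^+ 2 * d ^+ 2.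
    by rewrite -h5 -h6; ring.
  rewrite h8 in h4; rewrite E.
  move: h1 h2 h4 h7; rewrite -[8 * pp * _]mulrA -[2 * pp * _]mulrA.
  rewrite -[16 * _ * _]mulrA -[8 * _ * _]mulrA [q ^+ 2 * (2 * S)]mulrCA.
  lra.
have E2 : pp * (q * (tx ^+ 2 * (bx / px) - ty ^+ 2 * (by' / py))) = q * (tx ^+ 2 * a - ty
  ^+ 2 * b).
  by rewrite /pp /a /b; field; rewrite !gt_eqF.
set X := q * (tx ^+ 2 * (bx / px) - _) in E2 *.
rewrite -E2 in main.
have m2 : q ^+ 2 * S <= pp * (4 * X + 8 * pp * d ^+ 2).
  by apply: (le_trans main); rewrite le_eqVlt; apply/orP; left; apply/eqP; ring.
have pos : 0 <= 4 * X + 8 * pp * d ^+ 2.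
  rewrite -(pmulr_rge0 _ pp0); apply: le_trans m2; by rewrite mulr_ge0 ?sqr_ge0.
have m3 : q ^+ 2 * tx ^+ 2 <= B ^+ 2 * (4 * X + 8 * pp * d ^+ 2).
  apply: (le_trans _ (ler_wpM2r pos ppB)); apply: le_trans m2.
  by rewrite ler_wpM2l ?sqr_ge0 // lerDl sqr_ge0.
apply: (le_trans m3).
have h : B ^+ 2 * (8 * pp * d ^+ 2) <= 8 * B ^+ 4 * d ^+ 2.
  rewrite [leRHS](_ : _ = B ^+ 2 * (8 * B ^+ 2 * d ^+ 2)); last by ring.
  by rewrite ler_wpM2l ?sqr_ge0 // ler_wpM2r ?sqr_ge0 // ler_wpM2l.
rewrite mulrDr; apply: lerD => //.
by rewrite le_eqVlt; apply/orP; left; apply/eqP; ring.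
Qed.

(** * Integrals and limits *)

Lemma dominated_Rintegral d (T : measurableType d) (R : realType)
    (mu : {measure set T -> \bar R}) (f_ : nat -> T -> R) (f g : T -> R) :
  (forall n, measurable_fun setT (f_ n)) ->
  (forall x, f_ ^~ x @ \oo --> f x) ->
  mu.-integrable setT (EFin \o g) -> (forall n x, `|f_ n x| <= g x) ->
  (\int[mu]_x f_ n x) @[n --> \oo] --> \int[mu]_x f x.
Proof.
move=> mf ff ig fg.
have mff : measurable_fun setT f by apply: measurable_fun_cvg mf _ => x _; exact: ff.
have mfE n : measurable_fun setT (EFin \o f_ n) by exact/measurable_EFinP.
have mE : measurable_fun setT (EFin \o f) by exact/measurable_EFinP.
have H1 : {ae mu, forall x, setT x -> (EFin \o f_ n) x @[n --> \oo] --> (EFin \o f) x}.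
  by apply: aeW => x _; apply: cvg_EFin; [exact: nearW|exact: ff].
have H2 : {ae mu, forall x n, setT x -> (`|(EFin \o f_ n) x| <= (EFin \o g) x)%E}.
  by apply: aeW => x n _; rewrite lee_fin; exact: fg.
have [fi _ H] := dominated_convergence measurableT mfE mE H1 ig H2.
rewrite /Rintegral; apply: fine_cvg.
by rewrite fineK //; exact: integrable_fin_num fi.
Qed.

Lemma tensor_Rintegral d1 d2 (T1 : measurableType d1) (T2 : measurableType d2) (R : realType)
    (m1 : {sigma_finite_measure set T1 -> \bar R}) (m2 : {sigma_finite_measure set T2 ->
      \bar R})
    (f : T1 -> R) (g : T2 -> R) :
  m1.-integrable setT (EFin \o f) -> m2.-integrable setT (EFin \o g) ->
  (forall x, 0 <= f x) -> (forall y, 0 <= g y) ->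
  (m1 \x m2)%E.-integrable setT (EFin \o (fun p => f p.1 * g p.2)) /\
  \int[(m1 \x m2)%E]_p (f p.1 * g p.2) = (\int[m1]_x f x) * \int[m2]_y g y.
Proof.
move=> fi gi f0 g0.
have mf : measurable_fun setT f by exact/measurable_EFinP/(measurable_int _ fi).
have mg : measurable_fun setT g by exact/measurable_EFinP/(measurable_int _ gi).
have mfg : measurable_fun [set: T1 * T2] (EFin \o (fun p => f p.1 * g p.2)).
  apply/measurable_EFinP/measurable_funM.
    exact: (measurableT_comp mf measurable_fst).
  exact: (measurableT_comp mg measurable_snd).
have fg0 (p : T1 * T2) : (0 <= (f p.1 * g p.2)%:E)%E.
  by rewrite lee_fin mulr_ge0.
have E : (\int[m1 \x m2]_p (f p.1 * g p.2)%:E =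
    ((\int[m1]_x f x) * \int[m2]_y g y)%:E)%E.
  rewrite (fubini_tonelli1 (EFin \o (fun p => f p.1 * g p.2))) // /fubini_F /=.
  under eq_integral => x _.
    under eq_integral do rewrite EFinM.
    rewrite (integralZl measurableT gi) -(fineK (integrable_fin_num measurableT gi)) muleC.
    over.
  by rewrite (integralZl measurableT fi) -(fineK (integrable_fin_num measurableT fi))
    -EFinM mulrC.
split; last by rewrite /Rintegral E.
apply/integrableP; split => //.
rewrite (eq_integral (fun p => (f p.1 * g p.2)%:E)) ?E ?ltry // => p _.
by rewrite /= ger0_norm // mulr_ge0.
Qed.

Lemma cvg_minr (R : realType) (f g : nat -> R) (a b : R) :
  f n @[n --> \oo] --> a -> g n @[n --> \oo] --> b ->
  Num.min (f n) (g n) @[n --> \oo] --> Num.min a b.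
Proof.
move=> fa gb; rewrite minr_absE; under eq_fun do rewrite minr_absE.
apply: cvgM; last exact: cvg_cst.
by apply: cvgB; [exact: cvgD|apply: cvg_norm; exact: cvgB].
Qed.

Lemma cvg_norm_le (R : realType) (f : nat -> R) (a L : R) :
  f n @[n --> \oo] --> a -> (forall n, `|f n| <= L) -> `|a| <= L.
Proof.
move=> fa fL; apply: (@ler_cvg_to _ \oo _ _ (fun n => `|f n|) (fun=> L)).
- exact: cvg_norm.
- exact: cvg_cst.
- exact: nearW.
Qed.

(** * Integration over pairs of points *)

(** The concrete measurable type [plane R] enters only through the
    hypotheses below: a measurable map v to the Borel plane, invariance of
    the measure under [aff], and the area of boxes. In the application v is
    the identity of the plane, from the Lebesgue to the Borel sigma-algebra. *)
Section abstract_plane.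
Context (R : realType) d (P : measurableType d)
  (mu : {sigma_finite_measure set P -> \bar R}) (v : P -> R * R).
Hypothesis mv : measurable_fun [set: P] (v : P -> (measurableTypeR R * measurableTypeR R)%type).
Hypothesis aff_meas : forall s a (g : R * R -> \bar R),
  measurable_fun setT (g \o v) -> measurable_fun setT (g \o aff s a \o v).
Hypothesis aff_int : forall s a (g : R * R -> \bar R), measurable_fun setT (g \o v) ->
  (\int[mu]_x g (aff s a (v x)) = \int[mu]_x g (v x))%E.
Hypothesis mu_box : forall a b c e : R, a <= b -> c <= e ->
  mu (v @^-1` (`]a, b[%classic `*` `]c, e[%classic)) = ((b - a) * (e - c))%:E.

Local Notation m2 := (mu \x mu)%E.

Lemma measurable_continuous (f : R * R -> R) : continuous f -> measurable_fun setT (f \o v).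
Proof. by move=> /continuous_borel2 mf; exact: (measurableT_comp mf mv). Qed.

Lemma measurable_sub : measurable_fun [set: P * P]
  (fun p => v p.1 - v p.2 : (measurableTypeR R * measurableTypeR R)%type).
Proof.
have m1 : measurable_fun [set: P] (fun x => (v x).1 : measurableTypeR R).
  exact: (measurableT_comp measurable_fst mv).
have m2 : measurable_fun [set: P] (fun x => (v x).2 : measurableTypeR R).
  exact: (measurableT_comp measurable_snd mv).
apply: measurable_fun_pair.
  apply: (@measurable_funB _ _ R setT (fun p : P * P => (v p.1).1) (fun p => (v p.2).1)).
    exact: (measurableT_comp m1 measurable_fst).
  exact: (measurableT_comp m1 measurable_snd).
apply: (@measurable_funB _ _ R setT (fun p : P * P => (v p.1).2) (fun p => (v p.2).2)).
  exact: (measurableT_comp m2 measurable_fst).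
exact: (measurableT_comp m2 measurable_snd).
Qed.

Lemma measurable_continuous_sub (f : R * R -> R) : continuous f ->
  measurable_fun [set: P * P] (fun p => f (v p.1 - v p.2)).
Proof. by move=> /continuous_borel2 mf; exact: (measurableT_comp mf measurable_sub). Qed.

Lemma measurable_comp1 (f : R * R -> R) : measurable_fun setT (f \o v) ->
  measurable_fun [set: P * P] (fun p => f (v p.1)).
Proof. by move=> mf; exact: (measurableT_comp mf measurable_fst). Qed.

Lemma measurable_continuous1 (f : R * R -> R) : continuous f ->
  measurable_fun [set: P * P] (fun p => f (v p.1)).
Proof. by move=> cf; apply: measurable_comp1; exact: measurable_continuous. Qed.

Lemma measurable_comp2 (f : R * R -> R) : measurable_fun setT (f \o v) ->
  measurable_fun [set: P * P] (fun p => f (v p.2)).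
Proof. by move=> mf; exact: (measurableT_comp mf measurable_snd). Qed.

Lemma indic_ge0R (A : set (R * R)) x : 0 <= (\1_A x : R). Proof. by rewrite indicE ler0n. Qed.

Lemma mu_square c0 r : 0 <= r ->
  measurable (v @^-1` [set x | `|x - c0| < r]) /\
  mu (v @^-1` [set x | `|x - c0| < r]) = (4 * r ^+ 2)%:E.
Proof.
move=> r0.
have -> : [set x | `|x - c0| < r] =
    `]c0.1 - r, c0.1 + r[%classic `*` `]c0.2 - r, c0.2 + r[%classic.
  apply/seteqP; split => x; rewrite /= norm_prod_lt !in_itv /= !ltr_distl;
    first by move=> /andP[].
  by move=> [-> ->].
split; last by rewrite mu_box; [congr (_%:E); ring|lra|lra].
rewrite -[X in measurable X]setTI; apply: mv => //.
by apply: measurableX; exact: measurable_itv.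
Qed.

Lemma integrable_square c0 r : 0 <= r ->
  mu.-integrable setT (EFin \o (fun x => \1_[set y | `|y - c0| < r] (v x))) /\
  \int[mu]_x (\1_[set y | `|y - c0| < r] (v x)) = 4 * r ^+ 2.
Proof.
move=> r0; have [mA muA] := mu_square c0 r0.
have E : (\int[mu]_x (\1_(v @^-1` [set y | `|y - c0| < r]) x)%:E = (4 * r ^+ 2)%:E)%E.
  by rewrite (integral_indic _ measurableT mA) setIT; exact: muA.
split; last by rewrite /Rintegral -[X in fine X]/((\int[mu]_x (\1_(v @^-1` [set y | `|y -
  c0| < r]) x)%:E)%E) E.
apply/integrableP; split; first exact/measurable_EFinP/measurable_indicP.
rewrite (eq_integral (fun x => (\1_(v @^-1` [set y | `|y - c0| < r]) x)%:E)); last first.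
  by move=> x _; rewrite /= indicE ger0_norm.
by rewrite E ltry.
Qed.

Definition square0 (rho : R) : set (R * R) := [set x | `|x| < rho].

Let square0E rho : square0 rho = [set x | `|x - 0| < rho].
Proof. by apply/seteqP; split => x /=; rewrite subr0. Qed.

Lemma integrable_square0 rho : 0 <= rho ->
  mu.-integrable setT (EFin \o (fun x => \1_(square0 rho) (v x))).
Proof. by move=> /(integrable_square 0)[]; rewrite square0E. Qed.

Lemma Rintegral_square0 rho : 0 <= rho -> \int[mu]_x (\1_(square0 rho) (v x)) = 4 * rho ^+ 2.
Proof. by move=> /(integrable_square 0)[]; rewrite square0E. Qed.

Section product.
Variables (k : R * R -> R) (rho : R).
Hypotheses (rho0 : 0 <= rho) (k0 : forall z, 0 <= k z)
  (ik : mu.-integrable setT (EFin \o k \o v)).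

Let mk : measurable_fun setT (k \o v).
Proof. exact/measurable_EFinP/(measurable_int _ ik). Qed.

Lemma integrable_prod_square0 C : 0 <= C ->
  m2.-integrable setT (EFin \o (fun p => C * \1_(square0 rho) (v p.1) * k (v p.2))).
Proof.
move=> C0; have ii := integrableZl measurableT C (integrable_square0 rho0).
by have [] := tensor_Rintegral ii ik (fun x => mulr_ge0 C0 (ler0n _ _)) (fun z => k0 (v z)).
Qed.

Lemma Rintegral_prod_square0 C : 0 <= C ->
  \int[m2]_p (C * \1_(square0 rho) (v p.1) * k (v p.2)) =
    C * (4 * rho ^+ 2) * \int[mu]_z k (v z).
Proof.
move=> C0; have ii := integrableZl measurableT C (integrable_square0 rho0).
have [_ ->] := tensor_Rintegral ii ik (fun x => mulr_ge0 C0 (ler0n _ _)) (fun z => k0 (v z)).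
by rewrite RintegralZl // ?Rintegral_square0 //; exact: integrable_square0.
Qed.

Variables (Phi : R * R -> R * R -> R) (C : R).
Hypotheses (C0 : 0 <= C) (mPhi : measurable_fun setT (fun p : P * P => Phi (v p.1) (v p.2)))
 (Phi_le : forall x z, `|Phi x z| <= C * \1_(square0 rho) x * k z).

Lemma prod_integrable : m2.-integrable setT (EFin \o (fun p => Phi (v p.1) (v p.2))).
Proof.
apply: (le_integrable measurableT _ _ (integrable_prod_square0 C0));
  first exact/measurable_EFinP.
by move=> p _; rewrite /= lee_fin (le_trans (Phi_le _ _)) // ler_norm.
Qed.

End product.

(** The change of variables (x, z) |-> (x - z, - z), which exchanges the
    points x and x - z. It is done one variable at a time: reflect z, then
    translate x for fixed z. *)
Lemma Rintegral_shear (Phi : R * R -> R * R -> R) :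
  (forall z, measurable_fun setT (fun x => Phi (v x) z)) ->
  m2.-integrable setT (EFin \o (fun p => Phi (v p.1) (v p.2))) ->
  m2.-integrable setT (EFin \o (fun p => Phi (v p.1 - v p.2) (- v p.2))) ->
  \int[m2]_p Phi (v p.1) (v p.2) = \int[m2]_p Phi (v p.1 - v p.2) (- v p.2).
Proof.
move=> ms i1 i2; rewrite /Rintegral; congr fine.
rewrite -[LHS](integral21_prod_meas1 i1) -[RHS](integral21_prod_meas1 i2).
pose G z := (\int[mu]_x (Phi (v x) z)%:E)%E.
have mG : measurable_fun setT (G \o v) := measurable_fubini_G i1.
transitivity (\int[mu]_z G (v z))%E; first by [].
rewrite -(aff_int true 0 mG); apply: eq_integral => z _; rewrite aff_opp /G /fubini_G /=.
have mz : measurable_fun setT ((fun x => (Phi x (- v z))%:E) \o v).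
  by apply/measurable_EFinP; exact: ms.
rewrite -(aff_int false (- v z) mz); apply: eq_integral => x _.
by rewrite aff_shift addrC.
Qed.

Lemma Rintegral_opp (g : R * R -> R) : measurable_fun setT (g \o v) ->
  \int[mu]_z g (- v z) = \int[mu]_z g (v z).
Proof.
move=> mg; rewrite /Rintegral; congr fine.
have mg' : measurable_fun setT ((EFin \o g) \o v) by exact/measurable_EFinP.
rewrite -[RHS](aff_int true 0 mg'); apply: eq_integral => z _.
by rewrite aff_opp.
Qed.

(** * Truncated operators and the quadratic form *)

Section kernel.
Variables (K : R * R -> R) (R0 : R).
Hypotheses (K0 : forall z, 0 <= K z) (mK : measurable_fun setT (K \o v))
  (Keven : forall z, K (- z) = K z) (R0_gt0 : 0 < R0)
  (Ksupp : forall z, R0 <= `|z| -> K z = 0).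

(** All the integrals over pairs (x, z) are dominated by this density:
    increments of two Lipschitz functions contribute |z|^2. *)
Definition moment2 z := dot z z * K z.
Hypothesis iK : mu.-integrable setT (EFin \o moment2 \o v).
Definition second_moment := \int[mu]_z moment2 (v z).

(** The kernel of the truncated operator, with radii 1/(n+1) shrinking to
    zero. Its boundary circle is kept on the side of K, so that the integral
    is over the complement of the open ball. *)
Definition Ktrunc n z := if n.+1%:R^-1 <= enorm z then K z else 0.

Lemma moment2_ge0 z : 0 <= moment2 z. Proof. by rewrite mulr_ge0 ?dot_ge0. Qed.
Lemma moment2N z : moment2 (- z) = moment2 z. Proof. by rewrite /moment2 dotN Keven. Qed.
Lemma dominant_ge0 (A : set (R * R)) a x z : 0 <= a -> 0 <= a * \1_A x * moment2 z.
Proof. by move=> a0; rewrite mulr_ge0 ?moment2_ge0 // mulr_ge0 // indic_ge0R. Qed.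
Lemma second_moment_ge0 : 0 <= second_moment. Proof. by apply: Rintegral_ge0 => z _;
  exact: moment2_ge0. Qed.
Lemma Ktrunc_ge0 n z : 0 <= Ktrunc n z. Proof. by rewrite /Ktrunc; case: ifP. Qed.
Lemma Ktrunc_le n z : Ktrunc n z <= K z. Proof. by rewrite /Ktrunc; case: ifP. Qed.
Lemma Ktrunc_even n z : Ktrunc n (- z) = Ktrunc n z. Proof. by rewrite /Ktrunc enormN
  Keven. Qed.
Lemma Ktrunc_le_moment2 n z : Ktrunc n z <= n.+1%:R ^+ 2 * moment2 z.
Proof.
rewrite /Ktrunc; case: ifP => [h|_]; last by rewrite mulr_ge0 ?sqr_ge0 ?moment2_ge0.
rewrite /moment2 mulrA -sqr_enorm -exprMn ler_peMl // exprn_ege1 //.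
by rewrite -ler_pdivrMl // mulr1.
Qed.
Lemma measurable_Ktrunc n : measurable_fun setT (Ktrunc n \o v).
Proof.
rewrite (_ : Ktrunc n \o v = fun z => if (cst n.+1%:R^-1 z : R) <= (enorm (v z)) then K (v
  z) else 0) //.
apply: (@measurable_fun_ifT _ _ P R (K \o v) (cst 0)).
- apply: (@measurable_fun_ler _ _ R setT (cst n.+1%:R^-1)); first exact: measurable_cst.
  exact: (measurable_continuous (@continuous_enorm R)).
- exact: mK.
- exact: measurable_cst.
Qed.
Lemma Ktrunc_cvg (a : R) z : (dot z z = 0 -> a = 0) ->
  (a * Ktrunc n z) @[n --> \oo] --> a * K z.
Proof.
have [z0 a0|z0 _] := eqVneq (dot z z) 0.
  by rewrite a0 // mul0r; under eq_fun do rewrite mul0r; exact: cvg_cst.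
have e0 : 0 < enorm z by rewrite /enorm sqrtr_gt0 lt0r z0 dot_ge0.
apply: cvg_near_cst; near=> n; rewrite /Ktrunc ifT //; apply: ltW; near: n.
exact: (near_infty_natSinv_lt (PosNum e0)).
Unshelve. all: by end_near. Qed.

(** In the variable z = x - y. The principal value of the operator at x is
    the limit of these numbers as n tends to infinity. *)
Definition Ltrunc n (U : R * R -> R) x := \int[mu]_z ((U x - U (x - v z)) * Ktrunc n (v z)).

(** The bilinear form of the operator, in the variables x and z = x - y and
    without the usual factor 1/2; hence the factors 2 in the weak
    formulation. *)
Definition form (k : R * R -> R) (U X : R * R -> R) :=
  \int[m2]_p ((U (v p.1) - U (v p.1 - v p.2)) * (X (v p.1) - X (v p.1 - v p.2)) * k (v p.2)).

Lemma form_integrand_le (U X : R * R -> R) L L' rho k x z :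
  0 <= L -> 0 <= L' -> (forall z, 0 <= k z <= K z) ->
  lipschitz_with L U -> lipschitz_with L' X -> (forall x, rho <= `|x| -> X x = 0) ->
  `|(U x - U (x - z)) * (X x - X (x - z)) * k z| <= L * L' * \1_(square0 (rho + R0)) x *
    moment2 z.
Proof.
move=> L0 L'0 kK UL XL Xs; have [k0 kle] := andP (kK z).
have [zR|zR] := leP R0 `|z|.
  have -> : k z = 0 by apply/eqP; rewrite eq_le k0 andbT -(Ksupp zR).
  by rewrite mulr0 normr0 dominant_ge0 ?mulr_ge0.
have [xr|xr] := ltP `|x| (rho + R0); last first.
  have -> : X x = 0 by apply: Xs; rewrite (le_trans _ xr) // lerDl ltW.
  have -> : X (x - z) = 0.
    by apply/Xs/(le_trans _ (lerB_dist _ _)); rewrite lerBrDr (le_trans _ xr) // lerD2l ltW.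
  by rewrite subrr mulr0 mul0r normr0 dominant_ge0 ?mulr_ge0.
rewrite indicE mem_set // mulr1 !normrM (ger0_norm k0) /moment2.
have hU := UL x (x - z); have hX := XL x (x - z).
rewrite subKr in hU; rewrite subKr in hX.
rewrite mulrA ler_pM // ?mulr_ge0 //.
apply: (@le_trans _ _ ((L * `|z|) * (L' * `|z|))); first by rewrite ler_pM.
rewrite mulrACA -expr2 ler_wpM2l ?mulr_ge0 //; exact: sqr_norm_le_dot.
Qed.

Lemma measurable_form (U X k : R * R -> R) : continuous U -> continuous X ->
  measurable_fun setT (k \o v) ->
  measurable_fun setT (fun p : P * P =>
    (U (v p.1) - U (v p.1 - v p.2)) * (X (v p.1) - X (v p.1 - v p.2)) * k (v p.2)).
Proof.
move=> cU cX mk; apply: measurable_funM; last exact: measurable_comp2.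
by apply: measurable_funM; apply: measurable_funB; (try exact: measurable_continuous_sub);
  exact: measurable_continuous1.
Qed.

Lemma indic_shift_le rho x z : \1_(square0 rho) (x - z) * moment2 z <= \1_(square0 (rho +
  R0)) x * moment2 z.
Proof.
have [zR|zR] := leP R0 `|z|; first by rewrite /moment2 Ksupp // !mulr0.
rewrite ler_wpM2r ?moment2_ge0 // !indicE.
have [xz|xz] := boolP (x - z \in square0 rho); last by rewrite ler0n.
rewrite mem_set //; rewrite inE /= in xz.
by rewrite /square0 /= -[x](subrK z) (le_lt_trans (ler_normD _ _)) // ltrD.
Qed.

(** * From pointwise solutions to the weak form *)

Section weak_semiconcave.
Variables (U X c : R * R -> R) (C CX Cc L LX M rho : R).
Hypotheses (L0 : 0 <= L) (LX0 : 0 <= LX) (M0 : 0 <= M) (rho0 : 0 <= rho).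
Hypotheses (UL : lipschitz_with L U) (UC : forall x, `|U x| <= C)
  (Usc : forall x z, U (x + z) + U (x - z) - 2 * U x <= M * dot z z).
Hypotheses (XL : lipschitz_with LX X) (XC : forall x, 0 <= X x <= CX)
  (Xs : forall x, rho <= `|x| -> X x = 0).
Hypotheses (cc : continuous c) (cC : forall x, `|c x| <= Cc).
Hypothesis Uc : forall x, exists (b : nat -> R) (l : R),
  (forall n, b n <= Ltrunc n U x) /\ b n @[n --> \oo] --> l /\ c x <= l.

Let cU : continuous U := lipschitz_continuous UL.
Let cX : continuous X := lipschitz_continuous XL.
Let C0 : 0 <= C := le_trans (normr_ge0 _) (UC 0).
Let CX0 : 0 <= CX. Proof. by have /andP[h1 h2] := XC 0; exact: le_trans h2. Qed.
Let N n : R := n.+1%:R ^+ 2.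
Let N0 n : 0 <= N n. Proof. exact: sqr_ge0. Qed.

Let du_le x z : `|U x - U z| <= 2 * C.
Proof. by rewrite (le_trans (ler_normB _ _)) // mulr2n mulrDl mul1r lerD. Qed.

Let section_le n x z : `|(U x - U (x - z)) * Ktrunc n z| <= 2 * C * N n * moment2 z.
Proof.
rewrite normrM (ger0_norm (Ktrunc_ge0 _ _)) -[leRHS]mulrA ler_pM //; first exact: Ktrunc_ge0.
exact: Ktrunc_le_moment2.
Qed.

Let mU_shift x : measurable_fun setT ((fun z => U (x - z)) \o v).
Proof.
apply: measurable_continuous => z; apply: continuous_comp; last exact: cU.
by apply: cvgB; [exact: cvg_cst|exact: cvg_id].
Qed.

Let mU_shift' x : measurable_fun setT ((fun z => U (x + z)) \o v).
Proof.
apply: measurable_continuous => z; apply: continuous_comp; last exact: cU.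
by apply: cvgD; [exact: cvg_cst|exact: cvg_id].
Qed.

Let msec n x : measurable_fun setT ((fun z => (U x - U (x - z)) * Ktrunc n z) \o v).
Proof.
apply: measurable_funM; last exact: measurable_Ktrunc.
by apply: measurable_funB; [exact: measurable_cst|exact: mU_shift].
Qed.

Let isec n x : mu.-integrable setT (EFin \o (fun z => (U x - U (x - v z)) * Ktrunc n (v z))).
Proof.
apply: (le_integrable measurableT _ _ (integrableZl measurableT (2 * C * N n) iK)).
  exact/measurable_EFinP/msec.
by move=> z _; rewrite /= lee_fin (le_trans (section_le _ _ _)) // ler_norm.
Qed.

(** Averaging over z and - z turns the increment into a second difference,
    which semiconcavity controls by the second moment of the kernel. *)
Lemma Ltrunc_ge n x : - (M * second_moment) <= 2 * Ltrunc n U x.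
Proof.
have mg := msec n x.
have i1 := isec n x.
have E1 := Rintegral_opp mg.
have i2 : mu.-integrable setT (EFin \o (fun z => (U x - U (x + v z)) * Ktrunc n (v z))).
  apply: (le_integrable measurableT _ _ (integrableZl measurableT (2 * C * N n) iK)).
    apply/measurable_EFinP; apply: measurable_funM; last exact: measurable_Ktrunc.
    by apply: measurable_funB; [exact: measurable_cst|exact: mU_shift'].
  move=> z _; rewrite /= lee_fin; have := section_le n x (- v z).
  by rewrite Ktrunc_even opprK /moment2 dotN Keven => h; rewrite (le_trans h) // ler_norm.
have E : 2 * Ltrunc n U x = \int[mu]_z ((2 * U x - U (x + v z) - U (x - v z)) * Ktrunc n (v z)).
  rewrite /Ltrunc mulr2n mulrDl mul1r -{1}E1 -RintegralD //.
    by apply: eq_Rintegral => z _; rewrite Ktrunc_even opprK; ring.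
  by apply: eq_integrable i2 => // z _; rewrite /= Ktrunc_even opprK.
rewrite E /second_moment -[leLHS]mulNr -RintegralZl //.
apply: le_Rintegral => //.
- exact: (integrableZl measurableT (- M) iK).
- apply: eq_integrable (integrableD measurableT i2 i1) => // z _.
  by rewrite /= -EFinD; congr EFin; ring.
move=> z _; rewrite /moment2.
have h := Usc x (v z); have h0 := Ktrunc_ge0 n (v z); have h1 := Ktrunc_le n (v z).
apply: (@le_trans _ _ (- (M * dot (v z) (v z)) * Ktrunc n (v z))).
  by rewrite !mulNr lerN2 mulrA ler_wpM2l // mulr_ge0 // dot_ge0.
by apply: ler_wpM2r => //; lra.
Qed.

Let Phi n (x z : R * R) := (U x - U (x - z)) * Ktrunc n z * X x.

Let mPhi n : measurable_fun setT (fun p : P * P => Phi n (v p.1) (v p.2)).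
Proof.
apply: measurable_funM; last exact: (measurable_continuous1 cX).
apply: measurable_funM; last by apply: measurable_comp2; exact: measurable_Ktrunc.
by apply: measurable_funB; [exact: measurable_continuous1|exact: measurable_continuous_sub].
Qed.

Let Phi_le n x z : `|Phi n x z| <= 2 * C * N n * CX * \1_(square0 rho) x * moment2 z.
Proof.
rewrite /Phi normrM; have [h1 h2] := andP (XC x).
have [xr|xr] := leP rho `|x|.
  by rewrite Xs // normr0 mulr0 dominant_ge0 // !mulr_ge0.
rewrite indicE mem_set // mulr1 (ger0_norm h1) [leRHS]mulrAC ler_pM //.
Qed.

Let iPhi n : m2.-integrable setT (EFin \o (fun p => Phi n (v p.1) (v p.2))).
Proof.
apply: (prod_integrable rho0 moment2_ge0 iK _ (mPhi n) (Phi_le n)).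
by rewrite !mulr_ge0.
Qed.

(** For the truncated kernel the form splits into two integrable pieces, and
    exchanging x and x - z shows that they are equal. *)
Lemma form_truncated n : mu.-integrable setT (EFin \o (fun x => Ltrunc n U (v x) * X (v x))) /\
  2 * \int[mu]_x (Ltrunc n U (v x) * X (v x)) = form (Ktrunc n) U X.
Proof.
have i1 := iPhi n.
have E : fubini_F mu (EFin \o (fun p => Phi n (v p.1) (v p.2))) =
    EFin \o (fun x => Ltrunc n U (v x) * X (v x)).
  apply/funext => x; rewrite /fubini_F /=.
  have ix := isec n (v x).
  rewrite /Ltrunc -(RintegralZr _ measurableT ix) /Rintegral fineK //.
  by apply: integrable_fin_num => //; exact: (integrableZr measurableT (X (v x)) ix).
split; first by rewrite -E; exact: integrable_fubini_F i1.
have -> : \int[mu]_x (Ltrunc n U (v x) * X (v x)) = \int[m2]_p Phi n (v p.1) (v p.2).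
  rewrite /Rintegral -[in RHS](integral12_prod_meas1 i1); congr fine.
  by apply: eq_integral => x _; rewrite E.
have i2 : m2.-integrable setT (EFin \o (fun p => Phi n (v p.1 - v p.2) (- v p.2))).
  apply: (@prod_integrable _ (rho + R0) _ moment2_ge0 iK (fun x z => Phi n (x - z) (- z))
    (2 * C * N n * CX)).
  - by rewrite addr_ge0 // ltW.
  - by rewrite !mulr_ge0.
  - apply: measurable_funM; last exact: (measurable_continuous_sub cX).
    apply: measurable_funM.
      apply: measurable_funB; first exact: (measurable_continuous_sub cU).
      by under eq_fun do rewrite opprK subrK; exact: (measurable_continuous1 cU).
    by under eq_fun do rewrite Ktrunc_even; apply: measurable_comp2; exact: measurable_Ktrunc.
  move=> x z; rewrite (le_trans (Phi_le _ _ _)) //.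
  rewrite -mulrA -[leRHS]mulrA ler_wpM2l ?mulr_ge0 //.
  by rewrite moment2N; exact: indic_shift_le.
have mz z : measurable_fun setT (fun x => Phi n (v x) z).
  apply: measurable_funM; last exact: (measurable_continuous cX).
  apply: measurable_funM; last exact: measurable_cst.
  apply: measurable_funB; first exact: (measurable_continuous cU).
  apply: (measurable_continuous (f := fun x => U (x - z))) => x; apply: continuous_comp;
    last exact: cU.
  by apply: cvgB; [exact: cvg_id|exact: cvg_cst].
rewrite mulr2n mulrDl mul1r {2}(Rintegral_shear mz i1 i2) -RintegralD //.
by apply: eq_Rintegral => p _; rewrite /Phi opprK subrK Ktrunc_even; ring.
Qed.

(** Semiconcavity bounds the truncated operators from below uniformly in n,
    but nothing bounds them from above, so their integrals against X need
    not converge. The passage to the limit goes through the minimum with c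
    X, which is dominated and has limit c X. *)
Lemma weak_semiconcave : 2 * \int[mu]_x (c (v x) * X (v x)) <= form K U X.
Proof.
(* Bounded on both sides, with limit c X, and below the integrand of the
   truncated form. *)
pose g n x := Num.min (Ltrunc n U x * X x) (c x * X x).
have mcX : measurable_fun setT (fun x => c (v x) * X (v x)).
  by apply: measurable_funM;
    [exact: (measurable_continuous cc)|exact: (measurable_continuous cX)].
have mg n : measurable_fun setT (fun x => g n (v x)).
  apply: measurable_minr => //.
  by have [/(measurable_int _)/measurable_EFinP ? _] := form_truncated n.
pose B := (M * second_moment + Cc) * CX.
have k0 := second_moment_ge0.
have Cc0 : 0 <= Cc := le_trans (normr_ge0 _) (cC 0).
have cX_le x : `|c x * X x| <= Cc * CX.
  by have [h1 h2] := andP (XC x); rewrite normrM (ger0_norm h1) ler_pM.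
have g_le n x : `|g n x| <= B * \1_(square0 rho) x.
  have [xr|xr] := leP rho `|x|.
    by rewrite /g Xs // !mulr0 minxx normr0 mulr_ge0 ?indic_ge0R // mulr_ge0 // addr_ge0 //
      mulr_ge0.
  rewrite indicE mem_set // mulr1 ler_norml.
  have [h1 h2] := andP (XC x); have h3 := Ltrunc_ge n x.
  have := cX_le x; rewrite ler_norml => /andP[h4 h5].
  have Mk : 0 <= M * second_moment by rewrite mulr_ge0.
  have h6 : 0 <= M * second_moment * CX by rewrite mulr_ge0.
  apply/andP; split; rewrite /g /B mulrDl.
    rewrite le_min; apply/andP; split; last lra.
    have h7 : 0 <= Cc * CX by rewrite mulr_ge0.
    have h8 : - (M * second_moment) * X x <= Ltrunc n U x * X x by apply: ler_wpM2r => //; lra.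
    have h9 : M * second_moment * X x <= M * second_moment * CX by rewrite ler_wpM2l.
    rewrite mulNr in h8; lra.
  by rewrite ge_min; apply/orP; right; lra.
have ig : mu.-integrable setT (EFin \o (fun x => B * \1_(square0 rho) (v x))).
  exact: (integrableZl measurableT B (integrable_square0 rho0)).
have gcvg x : g n x @[n --> \oo] --> c x * X x.
  have [b [l [bL [bl cl]]]] := Uc x; have [h1 h2] := andP (XC x).
  apply: (@squeeze_cvgr _ _ _ _ (fun n => Num.min (b n * X x) (c x * X x)) (fun=> c x * X x)).
  - apply: nearW => n; apply/andP; split; last by rewrite /g ge_min lexx orbT.
    by rewrite /g le_min !ge_min lexx orbT andbT ler_wpM2r.
  - rewrite [X in _ --> X](_ : _ = Num.min (l * X x) (c x * X x)); last first.
        by rewrite min_r // ler_wpM2r.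
    by apply: cvg_minr; [apply: cvgMl|exact: cvg_cst].
  - exact: cvg_cst.
have c1 : \int[mu]_x g n (v x) @[n --> \oo] --> \int[mu]_x (c (v x) * X (v x)).
  apply: (dominated_Rintegral mg _ ig); first by move=> x; exact: gcvg.
  by move=> n x; exact: g_le.
have c2 : form (Ktrunc n) U X @[n --> \oo] --> form K U X.
  apply: (dominated_Rintegral (g := fun p => L * LX * \1_(square0 (rho + R0)) (v p.1) *
    moment2 (v p.2))).
  - by move=> n; apply: measurable_form => //; exact: measurable_Ktrunc.
  - move=> p; apply: Ktrunc_cvg => d0.
    by rewrite (dot_eq0 d0) subr0 !subrr mul0r.
  - apply: integrable_prod_square0 => //;
      [by rewrite addr_ge0 // ltW|exact: moment2_ge0|by rewrite mulr_ge0].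
  - by move=> n p; apply: (@form_integrand_le U X L LX rho (Ktrunc n)) => // z;
      rewrite Ktrunc_ge0 Ktrunc_le.
have c1' : 2 * (\int[mu]_x g n (v x)) @[n --> \oo] --> 2 * \int[mu]_x (c (v x) * X (v x)).
  by apply: cvgM c1; exact: cvg_cst.
apply: (ler_cvg_to c1' c2); apply: nearW => n.
have [iL <-] := form_truncated n; rewrite ler_wpM2l //; apply: le_Rintegral => //.
- apply: (le_integrable measurableT _ _ ig); first exact/measurable_EFinP.
  by move=> x _; rewrite /= lee_fin (le_trans (g_le _ _)) // ler_norm.
- by move=> x _; rewrite /g ge_min lexx.
Qed.

End weak_semiconcave.

Definition pv_solution (u F : R * R -> R) :=
  forall x, Ltrunc n u x @[n --> \oo] --> F x.

Lemma integrable_Ltrunc n (u : R * R -> R) x C : continuous u -> (forall x, `|u x| <= C) ->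
  mu.-integrable setT (EFin \o (fun z => (u x - u (x - v z)) * Ktrunc n (v z))).
Proof.
move=> cu uC; have C0 : 0 <= C := le_trans (normr_ge0 _) (uC 0).
apply: (le_integrable measurableT _ _ (integrableZl measurableT (2 * C * n.+1%:R ^+ 2) iK)).
  apply/measurable_EFinP; apply: measurable_funM; last exact: measurable_Ktrunc.
  apply: measurable_funB; first exact: measurable_cst.
  apply: (measurable_continuous (f := fun z => u (x - z))) => z; apply: continuous_comp;
    last exact: cu.
  by apply: cvgB; [exact: cvg_cst|exact: cvg_id].
move=> z _; rewrite /= lee_fin; apply: le_trans (ler_norm _).
rewrite normrM (ger0_norm (Ktrunc_ge0 _ _)) -[leRHS]mulrA ler_pM ?Ktrunc_ge0
  ?Ktrunc_le_moment2 //.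
by rewrite (le_trans (ler_normB _ _)) // mulr2n mulrDl mul1r lerD.
Qed.

Section form_lipschitz.
Variables (L LX rho : R).
Hypotheses (L0 : 0 <= L) (LX0 : 0 <= LX) (rho0 : 0 <= rho).

Lemma integrable_form U X : lipschitz_with L U -> lipschitz_with LX X ->
  (forall x, rho <= `|x| -> X x = 0) ->
  m2.-integrable setT (EFin \o (fun p => (U (v p.1) - U (v p.1 - v p.2)) *
    (X (v p.1) - X (v p.1 - v p.2)) * K (v p.2))).
Proof.
move=> UL XL Xs.
apply: (@prod_integrable _ (rho + R0) _ moment2_ge0 iK
  (fun x z => (U x - U (x - z)) * (X x - X (x - z)) * K z) (L * LX)).
- by rewrite addr_ge0 // ltW.
- by rewrite mulr_ge0.
- by apply: measurable_form => //; exact: lipschitz_continuous.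
- by move=> x z; apply: (@form_integrand_le U X L LX rho K) => // t; rewrite K0 lexx.
Qed.

Lemma cvg_form (U_ : nat -> R * R -> R) U X :
  (forall n, lipschitz_with L (U_ n)) -> lipschitz_with LX X ->
  (forall x, rho <= `|x| -> X x = 0) ->
  (forall x, U_ n x @[n --> \oo] --> U x) ->
  form K (U_ n) X @[n --> \oo] --> form K U X.
Proof.
move=> UL XL Xs UU.
apply: (dominated_Rintegral (g := fun p => L * LX * \1_(square0 (rho + R0)) (v p.1) *
  moment2 (v p.2))).
- by move=> n; apply: measurable_form => //; exact: lipschitz_continuous.
- move=> p; apply: cvgM; last exact: cvg_cst.
  by apply: cvgM; last exact: cvg_cst; apply: cvgB.
- apply: integrable_prod_square0;
    [by rewrite addr_ge0 // ltW|exact: moment2_ge0|exact: iK|by rewrite mulr_ge0].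
- by move=> n p; apply: (@form_integrand_le (U_ n) X L LX rho K) => // z; rewrite K0 lexx.
Qed.

End form_lipschitz.

Lemma integrable_supp (g : R * R -> R) C rho : 0 <= rho -> 0 <= C -> continuous g ->
  (forall x, `|g x| <= C) -> (forall x, rho <= `|x| -> g x = 0) ->
  mu.-integrable setT (EFin \o (fun x => g (v x))).
Proof.
move=> r0 C0 cg gC gs.
apply: (le_integrable measurableT _ _ (integrableZl measurableT C (integrable_square0 r0))).
  by apply/measurable_EFinP; exact: (measurable_continuous cg).
move=> x _; rewrite /= lee_fin; apply: le_trans (ler_norm _).
have [xr|xr] := leP rho `|v x|; first by rewrite gs // normr0 mulr_ge0 // indic_ge0R.
by rewrite indicE mem_set // mulr1.
Qed.

Section weak_form.
Variables (L LF LX C CF CX rho : R).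
Hypotheses (L0 : 0 <= L) (LF0 : 0 <= LF) (LX0 : 0 <= LX) (rho0 : 0 <= rho).

(** A pointwise principal value carries no uniformity in x, so it cannot be
    integrated directly. The inf-convolutions of u are semiconcave and
    satisfy the equation as an inequality up to an error tending to zero, by
    [infconv_touch]; their weak inequalities pass to the limit. *)
Lemma weak_form_ge u F X : lipschitz_with L u -> (forall x, `|u x| <= C) ->
  lipschitz_with LF F -> (forall x, `|F x| <= CF) -> pv_solution u F ->
  lipschitz_with LX X -> (forall x, 0 <= X x <= CX) -> (forall x, rho <= `|x| -> X x = 0) ->
  2 * \int[mu]_x (F (v x) * X (v x)) <= form K u X.
Proof.
move=> uL uC FL FC uF XL XC Xs.
have cX := lipschitz_continuous XL; have cF := lipschitz_continuous FL.
have CX0 : 0 <= CX by have /andP[h1 h2] := XC 0; exact: le_trans h2.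
have CF0 : 0 <= CF := le_trans (normr_ge0 _) (FC 0).
have XC' x : `|X x| <= CX by have /andP[h1 h2] := XC x; rewrite ger0_norm.
have iX : mu.-integrable setT (EFin \o (fun x => X (v x))).
  exact: (@integrable_supp X CX rho).
have iFX : mu.-integrable setT (EFin \o (fun x => F (v x) * X (v x))).
  apply: (@integrable_supp (fun x => F x * X x) (CF * CX) rho) => //; first by rewrite mulr_ge0.
  - by move=> x; apply: cvgM; [exact: cF|exact: cX].
  - by move=> x; rewrite normrM ler_pM.
  - by move=> x xr; rewrite Xs // mulr0.
have m0 n : 0 < n.+1%:R :> R by [].
pose U n := infconv (m0 n) uC uL.
(* th n bounds the variation of F between x and the point where the infimum
   that defines U n x is attained. *)
pose th n : R := LF * (L / n.+1%:R).
have th0 n : 0 <= th n by rewrite mulr_ge0 // divr_ge0.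
have step n : 2 * (\int[mu]_x (F (v x) * X (v x)) - th n * \int[mu]_x X (v x)) <= form K (U
  n) X.
  rewrite -RintegralZl // -RintegralB //; last exact: (integrableZl measurableT (th n) iX).
  have -> : \int[mu]_x (F (v x) * X (v x) - th n * X (v x)) = \int[mu]_x ((F (v x) - th n)
    * X (v x)).
    by apply: eq_Rintegral => x _; rewrite mulrBl.
  have UL := infconv_lipschitz (m0 n) uC uL.
  apply: (@weak_semiconcave (U n) X (fun x => F x - th n) C CX (CF + th n) L LX (2 *
    n.+1%:R) rho) => //.
  - exact: infconv_bounded.
  - exact: infconv_semiconcave.
  - by move=> x; apply: cvgB; [exact: cF|exact: cvg_cst].
  - by move=> x; rewrite (le_trans (ler_normB _ _)) // lerD // ger0_norm.
  move=> x; set y := infconv_pt (m0 n) uC uL x.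
  exists (fun k => Ltrunc k u y), (F y); split; last split; last first.
  - have := FL x y; have := ler_norm (F x - F y).
    have := infconv_pt_near (m0 n) L0 uC uL x; rewrite -/y => h1.
    have : LF * `|x - y| <= th n by rewrite ler_wpM2l.
    lra.
  - exact: uF.
  move=> k; apply: le_Rintegral => //.
  - by apply: (@integrable_Ltrunc _ _ _ C) => //; exact: (lipschitz_continuous uL).
  - apply: (@integrable_Ltrunc _ _ _ C) => //; first exact: (lipschitz_continuous UL).
    exact: infconv_bounded.
  - by move=> z _; rewrite ler_wpM2r ?Ktrunc_ge0 //; exact: infconv_touch.
have inv0 : (n.+1%:R^-1 : R) @[n --> \oo] --> 0 by exact: cvg_harmonic.
have thcvg : th n @[n --> \oo] --> 0.
  rewrite -[0](mulr0 (LF * L)); rewrite /th; under eq_fun do rewrite mulrA.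
  by apply: cvgM; [exact: cvg_cst|exact: inv0].
have l1 : 2 * (\int[mu]_x (F (v x) * X (v x)) - th n * \int[mu]_x X (v x)) @[n --> \oo]
    --> 2 * (\int[mu]_x (F (v x) * X (v x)) - 0 * \int[mu]_x X (v x)).
  apply: cvgM; first exact: cvg_cst.
  apply: cvgB; first exact: cvg_cst.
  by apply: cvgM; [exact: thcvg|exact: cvg_cst].
rewrite mul0r subr0 in l1.
have l2 : form K (U n) X @[n --> \oo] --> form K u X.
  apply: (cvg_form L0 LX0 rho0) => //; first by move=> n; exact: infconv_lipschitz.
  move=> x; apply: (@squeeze_cvgr _ _ _ _ (fun n => u x - L ^+ 2 / n.+1%:R) (fun=> u x)).
  - by apply: nearW => n; rewrite infconv_ge // infconv_le_u.
  - rewrite -[X in _ --> X]subr0; apply: cvgB; first exact: cvg_cst.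
    by rewrite -[0](mulr0 (L ^+ 2)); apply: cvgM; [exact: cvg_cst|exact: inv0].
  - exact: cvg_cst.
by apply: (ler_cvg_to l1 l2); apply: nearW.
Qed.

Lemma pv_solutionN u F : lipschitz_with L u -> (forall x, `|u x| <= C) ->
  pv_solution u F -> pv_solution (fun x => - u x) (fun x => - F x).
Proof.
move=> uL uC uF x; have cu := lipschitz_continuous uL.
rewrite (_ : (fun n => _) = (fun n => - Ltrunc n u x)); first by apply: cvgN; exact: uF.
apply/funext => n; rewrite -[RHS]mulN1r -RintegralZl //;
  last exact: (integrable_Ltrunc n x cu uC).
by apply: eq_Rintegral => z _; ring.
Qed.

Lemma formN u X : lipschitz_with L u -> lipschitz_with LX X ->
  (forall x, rho <= `|x| -> X x = 0) -> form K (fun x => - u x) X = - form K u X.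
Proof.
move=> uL XL Xs; rewrite -[RHS]mulN1r -RintegralZl //;
  last exact: (integrable_form L0 LX0 rho0 uL XL Xs).
by apply: eq_Rintegral => p _; ring.
Qed.

(** The opposite inequality comes from - u, and a test function of variable
    sign is the difference of its positive and negative parts. *)
Lemma weak_form u F X : lipschitz_with L u -> (forall x, `|u x| <= C) ->
  lipschitz_with LF F -> (forall x, `|F x| <= CF) -> pv_solution u F ->
  lipschitz_with LX X -> (forall x, `|X x| <= CX) -> (forall x, rho <= `|x| -> X x = 0) ->
  form K u X = 2 * \int[mu]_x (F (v x) * X (v x)).
Proof.
move=> uL uC FL FC uF XL XC Xs.
have CX0 : 0 <= CX := le_trans (normr_ge0 _) (XC 0).
have CF0 : 0 <= CF := le_trans (normr_ge0 _) (FC 0).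
have pos Y : lipschitz_with LX Y -> (forall x, 0 <= Y x <= CX) -> (forall x, rho <= `|x| ->
  Y x = 0) ->
    form K u Y = 2 * \int[mu]_x (F (v x) * Y (v x)).
  move=> YL YC Ys; apply/eqP; rewrite eq_le; apply/andP; split;
    last exact: weak_form_ge uF YL YC Ys.
  have iFY : mu.-integrable setT (EFin \o (fun x => F (v x) * Y (v x))).
    apply: (@integrable_supp (fun x => F x * Y x) (CF * CX) rho) => //;
      first by rewrite mulr_ge0.
    - by move=> x; apply: cvgM;
        [exact: (lipschitz_continuous FL)|exact: (lipschitz_continuous YL)].
    - by move=> x; have /andP[h1 h2] := YC x; rewrite normrM (ger0_norm h1) ler_pM.
    - by move=> x xr; rewrite Ys // mulr0.
  have h := weak_form_ge (lipschitzN uL) _ (lipschitzN FL) _ (pv_solutionN uL uC uF) YL YC Ys.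
  have {}h : 2 * \int[mu]_x (- F (v x) * Y (v x)) <= form K (fun x => - u x) Y.
    by apply: h => x; rewrite normrN.
  rewrite (formN uL YL Ys) in h.
  have E : \int[mu]_x (- F (v x) * Y (v x)) = - \int[mu]_x (F (v x) * Y (v x)).
    by rewrite -[RHS]mulN1r -RintegralZl //; apply: eq_Rintegral => x _; ring.
  by rewrite E in h; lra.
pose Y1 x := Num.max (X x) 0; pose Y2 x := Num.max (- X x) 0.
have E x : X x = Y1 x - Y2 x.
  by rewrite /Y1 /Y2; case: (leP (X x) 0) => h;
    [rewrite max_l ?oppr_ge0|rewrite max_r ?oppr_le0 ?ltW]; lra.
have Y1L : lipschitz_with LX Y1 by exact: lipschitz_max0.
have Y2L : lipschitz_with LX Y2 by apply: lipschitz_max0 => //; exact: lipschitzN.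
have Y1C x : 0 <= Y1 x <= CX.
  rewrite /Y1 le_max lexx orbT /= ge_max CX0 andbT; exact: le_trans (ler_norm _) (XC x).
have Y2C x : 0 <= Y2 x <= CX.
  by rewrite /Y2 le_max lexx orbT /= ge_max CX0 andbT; apply: le_trans (ler_norm _) _;
    rewrite normrN.
have Y1s x : rho <= `|x| -> Y1 x = 0 by move=> /Xs; rewrite /Y1 => ->; rewrite maxxx.
have Y2s x : rho <= `|x| -> Y2 x = 0 by move=> /Xs; rewrite /Y2 => ->; rewrite oppr0 maxxx.
have i1 := integrable_form L0 LX0 rho0 uL Y1L Y1s.
have i2 := integrable_form L0 LX0 rho0 uL Y2L Y2s.
have iF Y : lipschitz_with LX Y -> (forall x, 0 <= Y x <= CX) -> (forall x, rho <= `|x| ->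
  Y x = 0) ->
    mu.-integrable setT (EFin \o (fun x => F (v x) * Y (v x))).
  move=> YL YC Ys; apply: (@integrable_supp (fun x => F x * Y x) (CF * CX) rho) => //;
    first by rewrite mulr_ge0.
  - by move=> x; apply: cvgM;
      [exact: (lipschitz_continuous FL)|exact: (lipschitz_continuous YL)].
  - by move=> x; have /andP[h1 h2] := YC x; rewrite normrM (ger0_norm h1) ler_pM.
  - by move=> x xr; rewrite Ys // mulr0.
have -> : form K u X = form K u Y1 - form K u Y2.
  by rewrite -RintegralB //; apply: eq_Rintegral => p _; rewrite !E; ring.
have -> : \int[mu]_x (F (v x) * X (v x)) =
    \int[mu]_x (F (v x) * Y1 (v x)) - \int[mu]_x (F (v x) * Y2 (v x)).
  by rewrite -RintegralB //; [apply: eq_Rintegral => x _; rewrite !E; ring|exact: iF|exact: iF].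
by rewrite (pos Y1) // (pos Y2) // mulrBr.
Qed.

End weak_form.

(** * The energy estimate *)

Section energy.
Variables (w b Fw Fb tau : R * R -> R) (L LF LT C CF N rho : R).
Hypotheses (L0 : 0 <= L) (LF0 : 0 <= LF) (LT0 : 0 <= LT) (rho0 : 0 <= rho).
Hypotheses (w0 : forall x, 0 < w x) (wL : lipschitz_with L w) (bL : lipschitz_with L b)
  (wC : forall x, `|w x| <= C) (bC : forall x, `|b x| <= C)
  (FwL : lipschitz_with LF Fw) (FbL : lipschitz_with LF Fb)
  (FwC : forall x, `|Fw x| <= CF) (FbC : forall x, `|Fb x| <= CF)
  (wF : pv_solution w Fw) (bF : pv_solution b Fb)
  (tL : lipschitz_with LT tau) (tN : forall x, 0 <= tau x <= N)
  (ts : forall x, rho <= `|x| -> tau x = 0).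

Let C0 : 0 <= C := le_trans (normr_ge0 _) (wC 0).
Let N0 : 0 <= N. Proof. by have /andP[h1 h2] := tN 0; exact: le_trans h2. Qed.
Let cw := lipschitz_continuous wL.
Let cb := lipschitz_continuous bL.
Let ct := lipschitz_continuous tL.
Let p0 x : 0 < w x + `|b x|. Proof. by rewrite ltr_pwDl. Qed.
Let tN' x : `|tau x| <= N. Proof. by have /andP[h1 h2] := tN x; rewrite ger0_norm. Qed.

(** The quotient stays bounded by 1 however small w is, unlike b / w; no
    lower bound on w is available. *)
Definition quotient_test x := tau x ^+ 2 * (b x / (w x + `|b x|)).
Definition wronskian x z := b x * w (x - z) - b (x - z) * w x.
Let eta := quotient_test.
Let q := wronskian.
Let X1 x := tau x ^+ 2 * harm (w x) (b x).
Let X2 x := tau x ^+ 2 * (`|b x| - `|harm (w x) (b x)|).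

Let X1E x : X1 x = w x * eta x.
Proof. by rewrite /X1 /eta /quotient_test /harm; field; rewrite gt_eqF. Qed.
Let X2E x : X2 x = b x * eta x.
Proof.
rewrite /X2 /eta /quotient_test /harm !normrM normfV (gtr0_norm (w0 x)) (gtr0_norm (p0 x)).
rewrite [LHS](_ : _ = tau x ^+ 2 * (`|b x| ^+ 2 / (w x + `|b x|))); last by field;
  rewrite gt_eqF.
by rewrite real_normK ?num_real //; field; rewrite gt_eqF.
Qed.

Let hL : lipschitz_with (4 * L) (fun x => harm (w x) (b x)).
Proof.
move=> x y; rewrite (le_trans (harm_lipschitz _ _ (w0 x) (w0 y))) //.
have h1 := wL x y; have h2 := bL x y.
rewrite [leRHS](_ : _ = 2 * (L * `|x - y| + L * `|x - y|)); last by ring.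
by rewrite ler_wpM2l // lerD.
Qed.
Let hC x : `|harm (w x) (b x)| <= C.
Proof. by rewrite (le_trans (harm_le _ (w0 x))). Qed.
Let t2L : lipschitz_with (LT * N + N * LT) (fun x => tau x ^+ 2).
Proof. exact: lipschitzM tN' tN' tL tL. Qed.
Let t2C x : `|tau x ^+ 2| <= N ^+ 2.
Proof. by rewrite normrX lerXn2r ?nnegrE. Qed.

Let LX := (LT * N + N * LT) * C + N ^+ 2 * (L + 4 * L).
Let LX0 : 0 <= LX.
Proof. by rewrite addr_ge0 // mulr_ge0 ?sqr_ge0 // addr_ge0 // mulr_ge0. Qed.

Let X1L : lipschitz_with LX X1.
Proof.
move=> x y; apply: le_trans (lipschitzM t2C hC t2L hL x y) _.
by apply: ler_wpM2r => //; rewrite lerD2l ler_wpM2l ?sqr_ge0 // lerDr.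
Qed.
Let kC x : `|(`|b x| - `|harm (w x) (b x)|)| <= C.
Proof.
rewrite ger0_norm ?subr_ge0; last exact: harm_le.
by rewrite (le_trans _ (bC x)) // gerBl.
Qed.
Let X2L : lipschitz_with LX X2.
Proof.
apply: (lipschitzM t2C kC t2L).
exact: (lipschitzD (lipschitz_norm bL) (lipschitzN (lipschitz_norm hL))).
Qed.
Let X1C x : `|X1 x| <= N ^+ 2 * C. Proof. by rewrite normrM ler_pM. Qed.
Let X2C x : `|X2 x| <= N ^+ 2 * C. Proof. by rewrite normrM ler_pM. Qed.
Let X1s x : rho <= `|x| -> X1 x = 0.
Proof. by move=> /ts; rewrite /X1 => ->; rewrite expr0n mul0r. Qed.
Let X2s x : rho <= `|x| -> X2 x = 0.
Proof. by move=> /ts; rewrite /X2 => ->; rewrite expr0n mul0r. Qed.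

Let formE : form K b X1 - form K w X2 =
  2 * \int[mu]_x ((Fb (v x) * w (v x) - Fw (v x) * b (v x)) * eta (v x)).
Proof.
rewrite (weak_form L0 LF0 LX0 rho0 bL bC FbL FbC bF X1L X1C X1s).
rewrite (weak_form L0 LF0 LX0 rho0 wL wC FwL FwC wF X2L X2C X2s) -mulrBr.
have CF0 : 0 <= CF := le_trans (normr_ge0 _) (FwC 0).
have ii (F X : R * R -> R) : lipschitz_with LF F -> (forall x, `|F x| <= CF) ->
    lipschitz_with LX X -> (forall x, `|X x| <= N ^+ 2 * C) -> (forall x, rho <= `|x| ->
      X x = 0) ->
    mu.-integrable setT (EFin \o (fun x => F (v x) * X (v x))).
  move=> FL FC XL XC Xs.
  apply: (@integrable_supp (fun x => F x * X x) (CF * (N ^+ 2 * C)) rho) => //.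
  - by rewrite !mulr_ge0 ?sqr_ge0.
  - by move=> x; apply: cvgM;
      [exact: (lipschitz_continuous FL)|exact: (lipschitz_continuous XL)].
  - by move=> x; rewrite normrM ler_pM.
  - by move=> x xr; rewrite Xs // mulr0.
rewrite -RintegralB //; [|exact: ii|exact: ii].
by congr (2 * _); apply: eq_Rintegral => x _; rewrite X1E X2E; ring.
Qed.

Lemma integrable_energy : m2.-integrable setT (EFin \o (fun p => wronskian (v p.1) (v p.2)
  ^+ 2 * tau (v p.1) ^+ 2 * K (v p.2))).
Proof.
apply: (@prod_integrable _ rho rho0 moment2_ge0 iK (fun x z => wronskian x z ^+ 2 * tau x
  ^+ 2 * K z) ((2 * C * L) ^+ 2 * N ^+ 2)).
- by rewrite mulr_ge0 ?sqr_ge0.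
- apply: measurable_funM; last exact: measurable_comp2.
  apply: measurable_funM; last by apply/measurable_funX; exact: measurable_continuous1.
  apply: measurable_funX; apply: measurable_funB; apply: measurable_funM;
    (try exact: measurable_continuous1); exact: measurable_continuous_sub.
move=> x z; have [xr|xr] := leP rho `|x|.
  by rewrite ts // expr0n mulr0 mul0r normr0 dominant_ge0 // mulr_ge0 ?sqr_ge0.
rewrite indicE mem_set // mulr1 !normrM (ger0_norm (K0 z)) /moment2.
have qz : `|wronskian x z| <= 2 * C * L * `|z|.
  have -> : wronskian x z = w x * (b x - b (x - z)) - b x * (w x - w (x - z)) by rewrite
    /wronskian; ring.
  have h1 := bL x (x - z); have h2 := wL x (x - z); rewrite subKr in h1 h2.
  rewrite (le_trans (ler_normB _ _)) // !normrM.
  rewrite [leRHS](_ : _ = C * (L * `|z|) + C * (L * `|z|)); last by ring.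
  by apply: lerD; apply: ler_pM.
rewrite [leRHS](_ : _ = ((2 * C * L) ^+ 2 * dot z z) * N ^+ 2 * K z); last by ring.
apply: ler_wpM2r => //; apply: ler_pM => //.
apply: (@le_trans _ _ ((2 * C * L * `|z|) ^+ 2)).
  by rewrite expr2 ler_pM.
by rewrite exprMn ler_wpM2l ?sqr_ge0 // sqr_norm_le_dot.
by rewrite expr2 ler_pM.
Qed.

(** The equation of b is tested with w times [quotient_test] and that of w
    with b times it. In the difference, the products of values at x and at x
    - z combine into the wronskian times the increment of [quotient_test],
    and [energy_pointwise] applies under the integral. *)
Lemma energy_bound (B : R) : 2 * C <= B ->
  \int[m2]_p (wronskian (v p.1) (v p.2) ^+ 2 * tau (v p.1) ^+ 2 * K (v p.2)) <=
  4 * B ^+ 2 * (2 * \int[mu]_x ((Fb (v x) * w (v x) - Fw (v x) * b (v x)) * quotient_test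
    (v x)))
  + 8 * B ^+ 4 * form K tau tau.
Proof.
move=> CB; rewrite -/eta -formE.
have i1 := integrable_form L0 LX0 rho0 bL X1L X1s.
have i2 := integrable_form L0 LX0 rho0 wL X2L X2s.
have i3 := integrable_form LT0 LT0 rho0 tL tL ts.
rewrite /form -RintegralB // -RintegralZl //; last exact: (integrableB measurableT i1 i2).
rewrite -RintegralZl // -RintegralD //; last 2 first.
- exact: (integrableZl measurableT (4 * B ^+ 2) (integrableB measurableT i1 i2)).
- exact: (integrableZl measurableT (8 * B ^+ 4) i3).
have iq := integrable_energy.
apply: le_Rintegral => //.
- exact: (integrableD measurableT
    (integrableZl measurableT (4 * B ^+ 2) (integrableB measurableT i1 i2))
    (integrableZl measurableT (8 * B ^+ 4) i3)).
move=> p _; set x := v p.1; set z := v p.2.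
have pB y : w y + `|b y| <= B.
  by apply: le_trans CB; have := wC y; have := bC y; rewrite (gtr0_norm (w0 y)); lra.
have /andP[tx _] := tN x; have /andP[ty _] := tN (x - z).
have /= := energy_pointwise (w0 x) (w0 (x - z)) tx ty (pB _) (pB _).
move=> /(ler_wpM2r (K0 z)) h; apply: (le_trans h).
by rewrite !X1E !X2E /eta /quotient_test le_eqVlt; apply/orP; left; apply/eqP; ring.
Qed.

End energy.

(** * Vanishing of the wronskian *)

Section cutoff_form.
Variable rho : R.
Hypothesis rho_ge : R0 <= rho.
Let rho0 : 0 < rho := lt_le_trans R0_gt0 rho_ge.
Let s0 k : 0 < scale rho k. Proof. by rewrite mulr_gt0 // exprn_gt0. Qed.

(** Each of the N scales contributes at most scale^-2 times the area of the
    square of half-side 4 scale, that is 64, times the second moment: the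
    powers of the scale cancel in dimension two. *)
Lemma form_cutoff N : form K (cutoff rho N) (cutoff rho N) <= 64 * second_moment * N%:R.
Proof.
pose G n p := (\sum_(k < n) ((scale rho k) ^- 2 * \1_(square0 (4 * scale rho k)) (v p.1) *
  moment2 (v p.2))).
have GI n : m2.-integrable setT (EFin \o G n) /\ \int[m2]_p G n p = 64 * second_moment * n%:R.
  elim: n => [|n [IH1 IH2]].
    have E0 : G 0%N = cst 0 by apply/funext => p; rewrite /G big_ord0.
    by split; [rewrite E0; exact: integrable0|rewrite E0 Rintegral_cst // mul0r mulr0].
  have E : G n.+1 = fun p => G n p + (scale rho n) ^- 2 * \1_(square0 (4 * scale rho n)) (v
    p.1) * moment2 (v p.2).
    by apply/funext => p; rewrite /G big_ord_recr.
  have r4 : 0 <= 4 * scale rho n by rewrite mulr_ge0 // ltW.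
  have si : 0 <= (scale rho n) ^- 2 by rewrite invr_ge0 sqr_ge0.
  have i1 := integrable_prod_square0 r4 moment2_ge0 iK si.
  split; first by rewrite E; exact: (integrableD measurableT IH1 i1).
  rewrite E RintegralD // IH2 (Rintegral_prod_square0 r4 moment2_ge0 iK si) -/second_moment
    -natr1.
  by field; rewrite gt_eqF.
have [i1 <-] := GI N.
apply: le_Rintegral => //.
  pose LT : R := \sum_(k < N) (scale rho k)^-1.
  have LT0 : 0 <= LT by apply: sumr_ge0 => k _; rewrite invr_ge0 ltW.
  apply: (@integrable_form LT LT (scale rho N)) => //.
  - exact: ltW.
  - exact: (cutoff_lipschitz R0_gt0 rho_ge).
  - exact: (cutoff_lipschitz R0_gt0 rho_ge).
  - move=> x xr; apply: (cutoff_out R0_gt0 rho_ge).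
    by rewrite (le_trans xr) // ler_peMl // ler1n.
move=> p _; have [zR|zR] := leP R0 `|v p.2|.
  rewrite Ksupp // mulr0 sumr_ge0 // => k _.
  by rewrite dominant_ge0 // invr_ge0 sqr_ge0.
have := cutoff_energy R0_gt0 rho_ge N (v p.1) zR; rewrite expr2 => /(ler_wpM2r (K0 (v p.2))) h.
apply: (le_trans h); rewrite mulr_suml; apply: ler_sum => k _.
by rewrite /moment2 !mulrA lexx.
Qed.

End cutoff_form.

Lemma pv_quotient (u F : R * R -> R) C (e : R * R) (h : R) : continuous u ->
  (forall x, `|u x| <= C) ->
  pv_solution u F -> pv_solution (fun x => (u (x + e) - u x) / h) (fun x => (F (x + e) - F
    x) / h).
Proof.
move=> cu uC uF x.
rewrite (_ : (fun n => _) = (fun n => (Ltrunc n u (x + e) - Ltrunc n u x) / h)).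
  by apply: cvgM; [apply: cvgB; exact: uF|exact: cvg_cst].
apply/funext => n.
have i1 := integrable_Ltrunc n (x + e) cu uC; have i2 := integrable_Ltrunc n x cu uC.
rewrite /Ltrunc -RintegralB // -RintegralZr //; last exact: (integrableB measurableT i1 i2).
by apply: eq_Rintegral => z _; rewrite (addrAC x); ring.
Qed.

Lemma quotient_lipschitz (u : R * R -> R) L (e : R * R) (h : R) : 0 < h -> lipschitz_with L u ->
  lipschitz_with (2 * L / h) (fun x => (u (x + e) - u x) / h).
Proof.
move=> h0 uL x y; rewrite -mulrBl normrM (gtr0_norm (_ : 0 < h^-1)) ?invr_gt0 //.
rewrite [leRHS]mulrAC ler_wpM2r ?invr_ge0 ?(ltW h0) //.
have -> : u (x + e) - u x - (u (y + e) - u y) = (u (x + e) - u (y + e)) - (u x - u y) by ring.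
have := uL (x + e) (y + e); rewrite opprD addrACA subrr addr0 => h1.
have := uL x y; have := ler_normB (u (x + e) - u (y + e)) (u x - u y); lra.
Qed.

Lemma quotient_le (u : R * R -> R) L (e : R * R) (h : R) x : 0 < h -> `|e| <= h ->
  0 <= L -> lipschitz_with L u ->
  `|(u (x + e) - u x) / h| <= L.
Proof.
move=> h0 eh L0 uL; rewrite normrM (gtr0_norm (_ : 0 < h^-1)) ?invr_gt0 //.
rewrite ler_pdivrMr // (le_trans (uL _ _)) // ler_wpM2l //.
by rewrite addrAC subrr add0r.
Qed.

Section liouville.
Variables (u F phi psi Gphi Gpsi : R * R -> R) (L LF C m1 r1 : R).
Hypotheses (L0 : 0 <= L) (LF0 : 0 <= LF) (m1_gt0 : 0 < m1) (r1_gt0 : 0 < r1).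
Hypothesis K_ge : forall z, z != 0 -> `|z| < r1 -> m1 <= K z.
Hypotheses (uL : lipschitz_with L u) (uC : forall x, `|u x| <= C) (FL : lipschitz_with LF F)
  (uF : pv_solution u F).
Let h n : R := n.+1%:R^-1.
Let e1 n : R * R := (h n, 0).
Let e2 n : R * R := (0, h n).
Let D (g : R * R -> R) n (e : R * R) x := (g (x + e) - g x) / h n.
Hypotheses (u_incr : forall n x, u x < u (x + e2 n)).
Hypotheses (uphi : forall x, D u n (e2 n) x @[n --> \oo] --> phi x)
  (upsi : forall x, D u n (e1 n) x @[n --> \oo] --> psi x)
  (Fphi : forall x, D F n (e2 n) x @[n --> \oo] --> Gphi x)
  (Fpsi : forall x, D F n (e1 n) x @[n --> \oo] --> Gpsi x)
  (G0 : forall x, Gpsi x * phi x = Gphi x * psi x)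
  (cphi : continuous phi) (cpsi : continuous psi).

Let h0 n : 0 < h n. Proof. by rewrite invr_gt0. Qed.
Let w n := D u n (e2 n).
Let b n := D u n (e1 n).
Let e1h n : `|e1 n| <= h n.
Proof. by rewrite prod_normE /= normr0 ge_max (ltW (h0 n)) gtr0_norm // lexx. Qed.
Let e2h n : `|e2 n| <= h n.
Proof. by rewrite prod_normE /= normr0 ge_max (ltW (h0 n)) gtr0_norm // lexx. Qed.
Let w0 n x : 0 < w n x. Proof. by rewrite divr_gt0 // subr_gt0. Qed.
Let wC n x : `|w n x| <= L. Proof. exact: quotient_le. Qed.
Let bC n x : `|b n x| <= L. Proof. exact: quotient_le. Qed.

Let Q x z := psi x * phi (x - z) - psi (x - z) * phi x.

Section fixed_cutoff.
Variables (N : nat) (rho : R).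
Hypothesis rho_ge : R0 <= rho.
Let rho0 : 0 < rho := lt_le_trans R0_gt0 rho_ge.
Let tau := cutoff rho N.
Let sN0 : 0 < scale rho N. Proof. by rewrite mulr_gt0 // exprn_gt0. Qed.
Let ts x : scale rho N <= `|x| -> tau x = 0.
Proof.
move=> xr; apply: (cutoff_out R0_gt0 rho_ge).
by rewrite (le_trans xr) // ler_peMl // ler1n.
Qed.
Let tL : lipschitz_with (\sum_(k < N) (scale rho k)^-1) tau.
Proof. exact: (cutoff_lipschitz R0_gt0 rho_ge). Qed.
Let tN x : 0 <= tau x <= N%:R.
Proof. exact: cutoff_itv. Qed.

Let Err n x := (D F n (e1 n) x * w n x - D F n (e2 n) x * b n x) * quotient_test (w n) (b
  n) tau x.

Let Err_cvg : \int[mu]_x Err n (v x) @[n --> \oo] --> 0.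
Proof.
(* The integrands tend to zero pointwise, by the proportionality of the limits
   of the quotients, and are bounded independently of n with support in the
   square of half-side scale N. *)
have qle n x : `|quotient_test (w n) (b n) tau x| <= N%:R ^+ 2.
  have [h1 h2] := andP (tN x).
  have p0 : 0 < w n x + `|b n x| by rewrite ltr_pwDl.
  rewrite /quotient_test normrM normrX -[leRHS]mulr1 ler_pM ?sqr_ge0 //.
    by rewrite (ger0_norm h1) lerXn2r ?nnegrE.
  by rewrite normrM normfV (gtr0_norm p0) ler_pdivrMr // mul1r lerDr ltW.
have FC n x (e : R * R) : `|e| <= h n -> `|D F n e x| <= LF by move=> eh; exact: quotient_le.
have ErrC n x : `|D F n (e1 n) x * w n x - D F n (e2 n) x * b n x| <= 2 * LF * L.
  rewrite (le_trans (ler_normB _ _)) // [leRHS](_ : _ = LF * L + LF * L); last by ring.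
  have t1 := FC n x _ (e1h n); have t2 := FC n x _ (e2h n).
  have t3 := wC n x; have t4 := bC n x.
  by apply: lerD; rewrite normrM; apply: ler_pM.
have cD (g : R * R -> R) LG n e : lipschitz_with LG g -> continuous (D g n e).
  by move=> gL; exact: (lipschitz_continuous (quotient_lipschitz e (h0 n) gL)).
have cq n : continuous (quotient_test (w n) (b n) tau).
  have cb : continuous (b n) by exact: cD uL.
  have cw : continuous (w n) by exact: cD uL.
  move=> x; apply: cvgM.
    by apply: cvgM; exact: (lipschitz_continuous tL).
  apply: cvgM; first exact: cb.
  apply: cvgV; first by rewrite gt_eqF // ltr_pwDl.
  by apply: cvgD; [exact: cw|apply: cvg_norm; exact: cb].
have -> : 0 = \int[mu]_x (cst 0 x : R) by rewrite Rintegral_cst // mul0r.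
apply: (dominated_Rintegral (g := fun x => 2 * LF * L * N%:R ^+ 2 * \1_(square0 (scale rho
  N)) (v x))).
- move=> n; apply: (measurable_continuous (f := Err n)) => x; apply: cvgM; last exact: cq.
  by apply: cvgB; apply: cvgM; (try exact: (cD _ _ _ _ FL)); exact: (cD _ _ _ _ uL).
- move=> x; rewrite /Err.
  have l0 : (D F n (e1 n) (v x) * w n (v x) - D F n (e2 n) (v x) * b n (v x)) @[n --> \oo]
    --> 0.
    rewrite -(subrr (Gpsi (v x) * phi (v x))) {2}G0.
    by apply: cvgB; apply: cvgM; [exact: Fpsi|exact: uphi|exact: Fphi|exact: upsi].
  apply/norm_cvg0P.
  apply: (@squeeze_cvgr _ _ _ _ (fun=> 0) (fun n => `|D F n (e1 n) (v x) * w n (v x) - D F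
    n (e2 n) (v x) * b n (v x)| * N%:R ^+ 2)).
  - by apply: nearW => n; rewrite normr_ge0 normrM ler_wpM2l.
  - exact: cvg_cst.
  - rewrite -(mul0r (N%:R ^+ 2 : R)); apply: cvgM; last exact: cvg_cst.
    by apply/norm_cvg0P.
- have := integrable_square0 (ltW sN0) => /(integrableZl measurableT (2 * LF * L * N%:R ^+
    2)); exact.
- move=> n x; rewrite /Err; have [xr|xr] := leP (scale rho N) `|v x|.
    by rewrite /quotient_test ts // expr0n mul0r mulr0 normr0 mulr_ge0 ?indic_ge0R //
      !mulr_ge0 ?sqr_ge0.
  by rewrite indicE mem_set // mulr1 normrM ler_pM.
Qed.

Let q n x z := wronskian (w n) (b n) x z.

(** Near (x0, z0) the cut-off equals N and the kernel is at least m1, so the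
    energy controls N^2 m1 times the integral of the squared wronskian. As
    the step h n tends to zero, the right-hand sides of the two equations
    become proportional to the solutions, so their contribution vanishes,
    and only the energy of the cut-off remains. *)
Lemma wronskian_square_bound x0 z0 r : 0 < r -> `|x0| + r <= rho ->
  `|z0| + r <= r1 -> r <= `|z0| ->
  N%:R ^+ 2 * m1 * \int[m2]_p (\1_[set x | `|x - x0| < r] (v p.1) * \1_[set z | `|z - z0| <
    r] (v p.2) *
      Q (v p.1) (v p.2) ^+ 2) <= 8 * (2 * L) ^+ 4 * (64 * second_moment * N%:R).
Proof.
move=> r0 xr zr rz.
pose A := [set x | `|x - x0| < r]; pose B := [set z | `|z - z0| < r].
have [iA _] := integrable_square x0 (ltW r0); have [iB _] := integrable_square z0 (ltW r0).
have [iAB _] := tensor_Rintegral iA iB (fun x => indic_ge0R _ _) (fun z => indic_ge0R _ _).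
have AB0 x z : 0 <= \1_A x * \1_B z :> R by rewrite mulr_ge0 ?indic_ge0R.
have CF0 : 0 <= LF by [].
have cD (g : R * R -> R) LG n e : lipschitz_with LG g -> continuous (D g n e).
  by move=> gL; exact: (lipschitz_continuous (quotient_lipschitz e (h0 n) gL)).
have qC n x z : `|q n x z| <= 2 * L ^+ 2.
  rewrite /q /wronskian (le_trans (ler_normB _ _)) // [leRHS](_ : _ = L * L + L * L);
    last by ring.
  have t1 := wC n x; have t2 := bC n x; have t3 := wC n (x - z); have t4 := bC n (x - z).
  by apply: lerD; rewrite normrM; apply: ler_pM.
have mq n : measurable_fun [set: P * P] (fun p => q n (v p.1) (v p.2)).
  apply: measurable_funB; apply: measurable_funM.
  - exact: (measurable_continuous1 (cD _ _ n (e1 n) uL)).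
  - exact: (measurable_continuous_sub (cD _ _ n (e2 n) uL)).
  - exact: (measurable_continuous_sub (cD _ _ n (e1 n) uL)).
  - exact: (measurable_continuous1 (cD _ _ n (e2 n) uL)).
pose f n p := \1_A (v p.1) * \1_B (v p.2) * q n (v p.1) (v p.2) ^+ 2.
have mf n : measurable_fun [set: P * P] (f n).
  apply: measurable_funM; last exact: measurable_funX.
  by have /measurable_int/measurable_EFinP := iAB.
have ig := integrableZr measurableT ((2 * L ^+ 2) ^+ 2) iAB.
have f_le n p : `|f n p| <= \1_A (v p.1) * \1_B (v p.2) * (2 * L ^+ 2) ^+ 2.
  rewrite /f normrM ger0_norm // ler_wpM2l // normrX lerXn2r ?nnegrE //.
  by rewrite mulr_ge0 ?sqr_ge0.
have i_f n : m2.-integrable setT (EFin \o f n).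
  apply: (le_integrable measurableT _ _ ig); first exact/measurable_EFinP.
  by move=> p _; rewrite /= lee_fin; apply: le_trans (ler_norm _).
have lim1 : \int[m2]_p f n p @[n --> \oo] -->
    \int[m2]_p (\1_A (v p.1) * \1_B (v p.2) * Q (v p.1) (v p.2) ^+ 2).
  apply: (dominated_Rintegral mf _ ig f_le) => p.
  apply: cvgM; first exact: cvg_cst.
  by apply: cvgM; apply: cvgB; apply: cvgM; (try exact: upsi); exact: uphi.
pose LT : R := \sum_(k < N) (scale rho k)^-1.
have LT0 : 0 <= LT by apply: sumr_ge0 => k _; rewrite invr_ge0 mulr_ge0 ?exprn_ge0 // ltW.
have L2h n : 0 <= 2 * L / h n by rewrite divr_ge0 ?mulr_ge0 // ltW.
have LF2h n : 0 <= 2 * LF / h n by rewrite divr_ge0 ?mulr_ge0 // ltW.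
have cu := lipschitz_continuous uL.
have FC n x (e : R * R) : `|e| <= h n -> `|D F n e x| <= LF by move=> eh; exact: quotient_le.
have step n : N%:R ^+ 2 * m1 * \int[m2]_p f n p <=
    4 * (2 * L) ^+ 2 * (2 * \int[mu]_x Err n (v x)) + 8 * (2 * L) ^+ 4 * form K tau tau.
  have wL := quotient_lipschitz (e2 n) (h0 n) uL.
  have bL := quotient_lipschitz (e1 n) (h0 n) uL.
  have FwL := quotient_lipschitz (e2 n) (h0 n) FL.
  have FbL := quotient_lipschitz (e1 n) (h0 n) FL.
  have wF := @pv_quotient u F C (e2 n) (h n) cu uC uF.
  have bF := @pv_quotient u F C (e1 n) (h n) cu uC uF.
  apply: le_trans (energy_bound (L2h n) (LF2h n) LT0 (ltW sN0) (w0 n) wL bL (wC n) (bC n)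
    FwL FbL
    (fun x => FC n x _ (e2h n)) (fun x => FC n x _ (e1h n)) wF bF tL tN ts (lexx _)).
  have iE := integrable_energy (ltW sN0) wL bL (wC n) (bC n) tL tN ts.
  rewrite -RintegralZl //; apply: le_Rintegral => //.
    exact: (integrableZl measurableT (N%:R ^+ 2 * m1) (i_f n)).
  move=> p _; rewrite /f -/(q n _ _).
  set x := v p.1; set z := v p.2.
  have q2 : 0 <= q n x z ^+ 2 by exact: sqr_ge0.
  have rhs0 : 0 <= q n x z ^+ 2 * tau x ^+ 2 * K z.
    by apply: mulr_ge0 => //; apply: mulr_ge0 => //; exact: sqr_ge0.
  rewrite !indicE; have [xA|xA] := boolP (x \in A); last by rewrite mul0r mul0r mulr0.
  have [zB|zB] := boolP (z \in B); last by rewrite mulr0 mul0r mulr0.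
  rewrite !mul1r; move: xA zB; rewrite !inE /A /B /= => xA zB.
  have -> : tau x = N%:R.
    apply: (cutoff_center R0_gt0 rho_ge); rewrite -(subrK x0 x).
    by rewrite (le_trans (ler_normD _ _)) // (le_trans _ xr) // addrC lerD2l ltW.
  have Kz : m1 <= K z.
    apply: K_ge; last first.
      by rewrite -(subrK z0 z) (le_lt_trans (ler_normD _ _)) // (lt_le_trans _ zr) // addrC
        ltrD2l.
    by apply/eqP => z00; move: zB; rewrite z00 sub0r normrN ltNge rz.
  rewrite [leRHS](_ : _ = N%:R ^+ 2 * q n x z ^+ 2 * K z); last by ring.
  rewrite mulrAC ler_wpM2l // mulr_ge0 ?sqr_ge0 //.
have lim2 : N%:R ^+ 2 * m1 * \int[m2]_p f n p @[n --> \oo] --> N%:R ^+ 2 * m1 *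
    \int[m2]_p (\1_A (v p.1) * \1_B (v p.2) * Q (v p.1) (v p.2) ^+ 2).
  by apply: cvgM lim1; exact: cvg_cst.
have lim3 : 4 * (2 * L) ^+ 2 * (2 * \int[mu]_x Err n (v x)) + 8 * (2 * L) ^+ 4 * form K tau tau
    @[n --> \oo] --> 4 * (2 * L) ^+ 2 * (2 * 0) + 8 * (2 * L) ^+ 4 * form K tau tau.
  apply: cvgD; last exact: cvg_cst.
  apply: cvgM; first exact: cvg_cst.
  by apply: cvgM; [exact: cvg_cst|exact: Err_cvg].
have H := ler_cvg_to lim2 lim3 (nearW _ step).
apply: (le_trans (H _ _)); rewrite !mulr0 add0r.
by rewrite ler_wpM2l ?form_cutoff // mulr_ge0 // exprn_ge0 // mulr_ge0.
Qed.

End fixed_cutoff.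

(** Comparing the orders N^2 and N of the two sides of
    [wronskian_square_bound] as N grows, the squared wronskian has integral
    zero near (x0, z0), hence vanishes there by continuity. *)
Lemma wronskian_eq0 x0 z0 : `|z0| < r1 -> Q x0 z0 = 0.
Proof.
move=> z0r; apply/eqP/negPn/negP => Qn0.
have z00 : 0 < `|z0|.
  rewrite normr_gt0; apply: contra_neq Qn0 => ->.
  by rewrite /Q subr0 mulrC subrr.
(* If Q x0 z0 were nonzero, Q^2 would be at least c on a product of squares
   around x0 and z0, whose second factor avoids z = 0 and stays where K is
   bounded below. *)
pose c := Q x0 z0 ^+ 2 / 2.
have c0 : 0 < c by rewrite divr_gt0 // lt_def sqrf_eq0 Qn0 sqr_ge0.
have [r r0 [rz zr Qr]] : exists2 r, 0 < r & [/\ r <= `|z0|, `|z0| + r <= r1 &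
    forall x z, `|x - x0| < r -> `|z - z0| < r -> c <= Q x z ^+ 2].
  have cQ : {for (x0, z0), continuous (fun p : (R * R) * (R * R) => Q p.1 p.2 ^+ 2)}.
    have cs : continuous (fun p : (R * R) * (R * R) => p.1 - p.2).
      by move=> p; apply: cvgB; [exact: cvg_fst|exact: cvg_snd].
    have c1 g : continuous g -> continuous (fun p : (R * R) * (R * R) => g p.1 : R).
      by move=> cg p; apply: continuous_comp; [exact: cvg_fst|exact: cg].
    have c2 g : continuous g -> continuous (fun p : (R * R) * (R * R) => g (p.1 - p.2) : R).
      by move=> cg p; apply: continuous_comp; [exact: cs|exact: cg].
    have cQ1 : {for (x0, z0), continuous (fun p : (R * R) * (R * R) => Q p.1 p.2)}.
      by apply: cvgB; apply: cvgM;
        [exact: (c1 _ cpsi)|exact: (c2 _ cphi)|exact: (c2 _ cpsi)|exact: (c1 _ cphi)].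
    by apply: cvgM.
  have : \forall p \near (x0, z0), c < Q p.1 p.2 ^+ 2.
    by apply: (cvgr_gt _ cQ); rewrite /c /=; have := sqr_ge0 (Q x0 z0); move: c0;
      rewrite /c; lra.
  move=> /nbhs_ballP[e /= e0 He].
  exists (Num.min e (Num.min `|z0| (r1 - `|z0|))).
    by rewrite !lt_min e0 z00 subr_gt0.
  split.
  - by rewrite !ge_min lexx orbT.
  - by rewrite addrC -lerBrDr !ge_min lexx !orbT.
  move=> x z; rewrite !lt_min => /andP[xe _] /andP[ze _].
  apply/ltW/(He (x, z)); split; rewrite -ball_normE /= distrC //.
pose rho := Num.max R0 (`|x0| + r).
have rho_ge : R0 <= rho by rewrite le_max lexx.
have xr : `|x0| + r <= rho by rewrite le_max lexx orbT.
pose A := [set x | `|x - x0| < r]; pose B := [set z | `|z - z0| < r].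
pose I := \int[m2]_p (\1_A (v p.1) * \1_B (v p.2) * Q (v p.1) (v p.2) ^+ 2).
have bound N := wronskian_square_bound N rho_ge r0 xr zr rz.
have I0 : 0 < I.
  have phiC x : `|phi x| <= L.
    exact: (@cvg_norm_le R (fun n => w n x) (phi x) L (@uphi x) (fun n => wC n x)).
  have psiC x : `|psi x| <= L.
    exact: (@cvg_norm_le R (fun n => b n x) (psi x) L (@upsi x) (fun n => bC n x)).
  have QC x z : `|Q x z| <= 2 * L ^+ 2.
    rewrite /Q (le_trans (ler_normB _ _)) // [leRHS](_ : _ = L * L + L * L); last by ring.
    by apply: lerD; rewrite normrM; apply: ler_pM.
  have [iA EA] := integrable_square x0 (ltW r0); have [iB EB] := integrable_square z0 (ltW r0).
  have [iAB EAB] := tensor_Rintegral iA iB (fun x => indic_ge0R _ _) (fun z => indic_ge0R _ _).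
  rewrite -/A in iA EA; rewrite EA EB in EAB.
  have AB0 x z : 0 <= \1_A x * \1_B z :> R by rewrite mulr_ge0 ?indic_ge0R.
  have mQ : measurable_fun [set: P * P] (fun p => Q (v p.1) (v p.2)).
    apply: measurable_funB; apply: measurable_funM.
    - exact: measurable_continuous1.
    - exact: measurable_continuous_sub.
    - exact: measurable_continuous_sub.
    - exact: measurable_continuous1.
  have iQ : m2.-integrable setT (EFin \o (fun p => \1_A (v p.1) * \1_B (v p.2) * Q (v p.1)
    (v p.2) ^+ 2)).
    apply: (le_integrable measurableT _ _ (integrableZr measurableT ((2 * L ^+ 2) ^+ 2) iAB)).
      apply/measurable_EFinP/measurable_funM; last exact: measurable_funX.
      by have /measurable_int/measurable_EFinP := iAB.
    move=> p _; rewrite /= lee_fin; apply: le_trans (ler_norm _).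
    rewrite normrM ger0_norm // ler_wpM2l // normrX lerXn2r ?nnegrE //.
    by rewrite mulr_ge0 ?sqr_ge0.
  apply: (@lt_le_trans _ _ (c * (4 * r ^+ 2 * (4 * r ^+ 2)))).
    have r2 : 0 < 4 * r ^+ 2 by rewrite mulr_gt0 // exprn_gt0.
    by apply: mulr_gt0 => //; apply: mulr_gt0.
  rewrite -EAB -RintegralZl //; apply: le_Rintegral => //.
    exact: (integrableZl measurableT c iAB).
  move=> p _; rewrite !indicE.
  have [xA|xA] := boolP (v p.1 \in A); last by rewrite !mul0r mulr0.
  have [zB|zB] := boolP (v p.2 \in B); last by rewrite mulr0 mulr0 mul0r.
  by rewrite !mul1r mulr1; apply: Qr; [move: xA|move: zB]; rewrite inE.
pose c1 := 8 * (2 * L) ^+ 4 * (64 * second_moment).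
(* Large enough to contradict N^2 m1 I <= c1 N. *)
pose N := (Num.truncn (c1 / (m1 * I))).+1.
have N0 : 0 < N%:R :> R by [].
have mI : 0 < m1 * I by rewrite mulr_gt0.
have h1 : c1 / (m1 * I) < N%:R by rewrite truncnS_gt.
have := bound N; rewrite leNgt => /negP; apply.
rewrite -/A -/B -/I [ltLHS](_ : _ = c1 * N%:R); last by rewrite /c1; ring.
rewrite [ltRHS](_ : _ = N%:R * (m1 * I) * N%:R); last by ring.
by rewrite ltr_pM2r // -ltr_pdivrMr.
Qed.

Hypothesis phi0 : forall x, 0 < phi x.

(** Vanishing of the wronskian for |z| < r1 makes psi / phi agree at points
    at distance less than r1, and every point is joined to the origin by
    finitely many such steps. *)
Lemma gradient_direction : exists c, forall x, psi x = c * phi x.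
Proof.
have phin0 x : phi x != 0 by rewrite gt_eqF.
exists (psi 0 / phi 0).
have step n x : `|x| < n.+1%:R * r1 -> psi x / phi x = psi 0 / phi 0.
  elim: n x => [|n IH] x xr.
    have := @wronskian_eq0 x x; rewrite mul1r in xr; move=> /(_ xr); rewrite /Q subrr => /eqP.
    rewrite subr_eq0 => /eqP E; apply/eqP.
    by rewrite eqr_div ?phin0 // E.
  (* The previous point y on the segment from 0 to x, at distance less than
     r1. *)
  pose t : R := n.+1%:R / n.+2%:R.
  have t0 : 0 <= t by rewrite divr_ge0.
  pose y := t *: x.
  have yr : `|y| < n.+1%:R * r1.
    rewrite normrZ ger0_norm // /t mulrAC ltr_pdivrMr // -mulrA ltr_pM2l // mulrC //.
  rewrite -(IH y yr).
  have xy : `|x - y| < r1.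
    have -> : x - y = n.+2%:R^-1 *: x.
      rewrite -{1}[x]scale1r -scalerBl; congr (_ *: _).
      rewrite /t -{1}(@divff _ (n.+2%:R : R)) ?pnatr_eq0 //.
      by rewrite -mulrBl -natrB // subSnn mul1r.
    by rewrite normrZ ger0_norm ?invr_ge0 // mulrC ltr_pdivrMr // mulrC.
  have := wronskian_eq0 x xy; rewrite /Q subKr => /eqP.
  rewrite subr_eq0 => /eqP E; apply/eqP.
  by rewrite eqr_div ?phin0 // E.
move=> x; rewrite -(step (Num.truncn (`|x| / r1)) x); first by rewrite divfK ?gt_eqF.
by rewrite -ltr_pdivrMr // truncnS_gt.
Qed.

End liouville.
End kernel.

(** * Symmetrization of the kernel *)

Section symmetrization.
Variables (K : R * R -> R).
Hypotheses (mK : measurable_fun setT (K \o v))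
  (Kae : {ae mu, forall z, K (v z) = K (- v z)}).

(** The kernel K is only even almost everywhere. Its even part is even
    everywhere, defines the same operator, and inherits the pointwise
    bounds. *)
Definition symm z := (K z + K (- z)) / 2.

Lemma symm_even z : symm (- z) = symm z.
Proof. by rewrite /symm opprK addrC. Qed.

Lemma symm_between a b z : a <= K z <= b -> a <= K (- z) <= b -> a <= symm z <= b.
Proof. by rewrite /symm => /andP[? ?] /andP[? ?]; apply/andP; split; lra. Qed.

Lemma measurable_reflect : measurable_fun setT ((fun z => K (- z)) \o v).
Proof.
have mE : measurable_fun setT ((EFin \o K) \o v) by exact/measurable_EFinP.
have := aff_meas true 0 mE => /measurable_EFinP.
by apply: eq_measurable_fun => z _ /=; rewrite aff_opp.
Qed.

Lemma measurable_symm : measurable_fun setT (symm \o v).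
Proof.
apply: measurable_funM; last exact: measurable_cst.
by apply: measurable_funD; [exact: mK|exact: measurable_reflect].
Qed.

Section value.
Variables (u : R * R -> R) (x : R * R) (l : R).
Hypotheses (cu : continuous u).
Let g y := (u x - u y) * K (x - y).
Let rn n : R := n.+1%:R^-1.
Let H n z := (u x - u (x - z)) * Ktrunc K n z.

Let mH n : measurable_fun setT (H n \o v).
Proof.
apply: measurable_funM.
  apply: measurable_funB; first exact: measurable_cst.
  apply: (measurable_continuous (f := fun z => u (x - z))) => z; apply: continuous_comp;
    last exact: cu.
  by apply: cvgB; [exact: cvg_cst|exact: cvg_id].
exact: measurable_Ktrunc.
Qed.

Let meball r : measurable (v @^-1` eball x r).
Proof.
rewrite (_ : _ @^-1` _ = (fun y => enorm (v y - x)) @^-1` `]-oo, r[%classic); last first.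
  by apply/seteqP; split => y /=; rewrite /eball /= in_itv.
rewrite -[X in measurable X]setTI;
  apply: (measurable_continuous (f := fun y => enorm (y - x))) => //.
  move=> y; apply: continuous_comp; last exact: continuous_enorm.
  by apply: cvgB; [exact: cvg_id|exact: cvg_cst].
Qed.

(** The change of variable y = x - z, and almost everywhere equality of the
    kernels. *)
Lemma truncated_value n :
  mu.-integrable setT (EFin \o (fun z => (u x - u (x - v z)) * Ktrunc symm n (v z))) ->
  (\int[mu]_(y in ~` (v @^-1` eball x (rn n))) (g (v y))%:E)%E = (Ltrunc symm n u x)%:E.
Proof.
move=> iL.
rewrite integral_mkcond.
have E y : ((fun y => (g (v y))%:E) \_ (~` (v @^-1` eball x (rn n)))) y = (H n (aff true x
  (v y)))%:E.
  rewrite patchE aff_sub /H subKr /Ktrunc -[enorm (x - v y)]enormN opprB /g.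
  have [yB|yB] := boolP (y \in ~` (v @^-1` eball x (rn n))).
    rewrite ifT //; move: yB; rewrite inE /= /eball /= => /negP.
    by rewrite -leNgt.
  rewrite ifF ?mulr0 //; move: yB; rewrite notin_setE /= => /contrapT.
  by rewrite /eball /= ltNge => /negbTE.
rewrite (eq_integral _ _ (fun y _ => E y)).
have mHE : measurable_fun setT ((EFin \o H n) \o v) by exact/measurable_EFinP/mH.
rewrite (aff_int true x mHE).
rewrite /Ltrunc /Rintegral fineK; last exact: integrable_fin_num iL.
apply: ae_eq_integral => //.
- exact: (measurable_int _ iL).
- apply: filterS Kae => z Kz _ /=; congr (_%:E); rewrite /H; congr (_ * _).
  by rewrite /Ktrunc /symm -Kz; case: ifP => // _; lra.
Qed.

Lemma pv_of_principal_value :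
  (forall n, mu.-integrable setT (EFin \o (fun z => (u x - u (x - v z)) * Ktrunc symm n (v
    z)))) ->
  (\int[mu]_(y in ~` (v @^-1` eball x r)) (g (v y))%:E)%E @[r --> 0^'+] --> l%:E ->
  Ltrunc symm n u x @[n --> \oo] --> l.
Proof.
move=> iL H1.
have H2 : (Ltrunc symm n u x)%:E @[n --> \oo] --> l%:E.
  have /cvge_at_rightP/(_ rn) := H1.
  rewrite (_ : (fun n => _) = (fun n => (Ltrunc symm n u x)%:E)).
    by apply; split; [move=> n; rewrite invr_gt0|exact: cvg_harmonic].
  by apply/funext => n; exact: truncated_value.
exact: (fine_cvg H2).
Qed.

(** An absolutely convergent integral is the limit of its truncations, by
    dominated convergence. At y = x, where no truncation reaches, the
    increment of u is zero. *)
Lemma pv_of_integral_value :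
  (forall n, mu.-integrable setT (EFin \o (fun z => (u x - u (x - v z)) * Ktrunc symm n (v
    z)))) ->
  mu.-integrable setT (EFin \o (fun y => g (v y))) ->
  (\int[mu]_y (g (v y))%:E)%E = l%:E ->
  Ltrunc symm n u x @[n --> \oo] --> l.
Proof.
move=> iL ig gl.
have -> : l = \int[mu]_y g (v y) by rewrite /Rintegral gl.
have E n : Ltrunc symm n u x = \int[mu]_y (g (v y) * \1_(~` (v @^-1` eball x (rn n))) y).
  rewrite -[LHS]/(fine (Ltrunc symm n u x)%:E) -truncated_value // integral_mkcond /Rintegral.
  congr fine; apply: eq_integral => y _; rewrite patchE indicE.
  by case: ifP => _; rewrite ?mulr1 ?mulr0.
under eq_fun do rewrite E.
have mg := measurable_int _ ig.
apply: (dominated_Rintegral (g := fun y => `|g (v y)|)).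
- move=> n; apply: measurable_funM; first exact/measurable_EFinP.
  by apply/measurable_indicP; apply: measurableC.
- move=> y.
  have [yx|yx] := eqVneq (dot (v y - x) (v y - x)) 0.
    have -> : g (v y) = 0.
      rewrite /g; have /subr0_eq -> := dot_eq0 yx; by rewrite subrr mul0r.
    by under eq_fun do rewrite mul0r; exact: cvg_cst.
  have e0 : 0 < enorm (v y - x) by rewrite /enorm sqrtr_gt0 lt0r yx dot_ge0.
  apply: cvg_near_cst; near=> n; rewrite indicE mem_set ?mulr1 //=.
  rewrite /eball /=; apply/negP; rewrite -leNgt; apply: ltW; near: n.
  exact: (near_infty_natSinv_lt (PosNum e0)).
- exact: integrable_norm ig.
- move=> n y; rewrite normrM ler_piMr // ger0_norm indicE ?ler0n //.
  by case: (_ \in _); rewrite ?lexx ?ler01.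
Unshelve. all: by end_near. Qed.

End value.
End symmetrization.

(** * Finiteness of the second moment *)

Section moment_integrability.
Variables (K : R * R -> R) (M0 r0 s : R).
Hypotheses (mK : measurable_fun setT (K \o v)) (K0 : forall z,
  0 <= K z) (r0_gt0 : 0 < r0) (M0_ge0 : 0 <= M0).

Lemma integrable_moment2_bounded : (forall z, K z <= M0 * \1_(square0 r0) z) ->
  mu.-integrable setT (EFin \o moment2 K \o v).
Proof.
move=> KM.
apply: (le_integrable measurableT _ _ (integrableZl measurableT (2 * r0 ^+ 2 * M0)
  (integrable_square0 (ltW r0_gt0)))).
  apply/measurable_EFinP/measurable_funM; last exact: mK.
  exact: (measurable_continuous (@continuous_dot R)).
move=> z _; rewrite /= lee_fin; apply: le_trans (ler_norm _).
rewrite ger0_norm; last by rewrite /moment2 mulr_ge0 ?dot_ge0.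
have := KM (v z); rewrite indicE; have [zr|zr] := boolP (v z \in square0 r0); last first.
  rewrite !mulr0 => Kz; have K1 : K (v z) = 0 by apply/eqP; rewrite eq_le Kz K0.
  by rewrite /moment2 K1 mulr0.
rewrite !mulr1 => Kz; rewrite /moment2; apply: ler_pM => //; first exact: dot_ge0.
move: zr; rewrite inE /square0 /= => zr.
have z1 := norm1_le (v z); have z2 := norm2_le (v z).
rewrite /dot -!expr2 -(real_normK (num_real (v z).1)) -(real_normK (num_real (v z).2)).
by rewrite mulr2n mulrDl mul1r lerD // lerXn2r ?nnegrE ?(ltW r0_gt0) // ltW // (le_lt_trans
  _ zr).
Qed.

Hypothesis s01 : 0 < s < 1.

Let s_gt0 : 0 < s. Proof. by case/andP: s01. Qed.
Let q : R := 4^-1 `^ (1 - s).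
Let b : R := 4^-1 `^ s.
Let rho k : R := r0 / 2 ^+ k.
Let c k : R := M0 / ((rho k.+1 ^+ 2) `^ s).

Let b_gt0 : 0 < b. Proof. by rewrite powR_gt0. Qed.

Let q_gt0 : 0 < q. Proof. by rewrite powR_gt0. Qed.

Let q_lt1 : q < 1.
Proof.
have <- : 1 `^ (1 - s) = 1 :> R by rewrite powR1.
apply: gt0_ltr_powR; rewrite ?nnegrE ?invr_ge0 ?ler01 //.
  by case/andP: s01 => _; rewrite subr_gt0.
by rewrite invf_lt1 ?ltr1n.
Qed.

Let qb : q * b = 4^-1.
Proof.
rewrite /q /b -powRD; last by apply/implyP => _; rewrite invr_eq0 pnatr_eq0.
by rewrite subrK powRr1 // invr_ge0.
Qed.

Let rho_gt0 k : 0 < rho k. Proof. by rewrite divr_gt0 // exprn_gt0. Qed.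

Let sqr_rho k : rho k ^+ 2 = r0 ^+ 2 * 4^-1 ^+ k.
Proof. rewrite /rho expr_div_n -exprM mulnC exprM exprVn.
by have -> : 2 ^+ 2 = 4 :> R by rewrite -natrX. Qed.

Let mass k : c k * (4 * rho k ^+ 2) = geometric (4 * M0 * r0 ^+ 2 / ((r0 ^+ 2) `^ s * b)) q k.
Proof.
have X0 : 0 < (r0 ^+ 2) `^ s by rewrite powR_gt0 // exprn_gt0.
have E : (rho k.+1 ^+ 2) `^ s = (r0 ^+ 2) `^ s * b ^+ k.+1.
  rewrite sqr_rho powRM ?sqr_ge0 ?exprn_ge0 ?invr_ge0 //; congr (_ * _).
  by rewrite -[4^-1 ^+ _]powR_mulrn ?invr_ge0 // powRAC powR_mulrn // ltW.
rewrite /c E sqr_rho -qb exprMn [b ^+ k.+1]exprS /=.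
move: X0; set X := _ `^ s => X0.
have bk : b ^+ k != 0 by rewrite expf_neq0 // gt_eqF.
by field; rewrite bk !gt_eqF.
Qed.

(** On the annulus between the squares of half-side rho (k+1) and rho k,
    with rho k = r0 2^-k, the density is at most c k = M0 rho (k+1)^(-2s).
    The areas are of order 4^-k, so the sum is geometric with ratio q =
    4^(s-1) < 1. *)
Lemma integrable_moment2_fractional :
  (forall z, z != 0 -> dot z z * (dot z z) `^ s * K z <= M0 * \1_(square0 r0) z) ->
  mu.-integrable setT (EFin \o moment2 K \o v).
Proof.
move=> KM.
have mk : measurable_fun setT (EFin \o moment2 K \o v).
  apply/measurable_EFinP/measurable_funM; last exact: mK.
  exact: (measurable_continuous (@continuous_dot R)).
have c0 k : 0 <= c k by rewrite /c divr_ge0 ?powR_ge0.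
pose h k z : \bar R := (c k * \1_(square0 (rho k)) (v z))%:E.
have h0 k z : (0 <= h k z)%E by rewrite lee_fin mulr_ge0.
have mh k : measurable_fun setT (h k).
  exact: (measurable_int _ (integrableZl measurableT (c k) (integrable_square0 (ltW
    (rho_gt0 k))))).
have k0 z : 0 <= moment2 K (v z) by rewrite mulr_ge0 ?dot_ge0.
have ptw z : ((moment2 K (v z))%:E <= \sum_(0 <= k <oo) h k z)%E.
  have [z0|z0] := eqVneq (v z) 0.
    rewrite /moment2 z0 /dot /= !mulr0 addr0 mul0r; exact: nneseries_ge0.
  have := KM _ z0; rewrite indicE; have [zr|zr] := boolP (v z \in square0 r0); last first.
    have D0 : 0 < dot (v z) (v z).
      rewrite lt0r dot_ge0 andbT; apply/eqP => /eqP.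
      by apply/negP; apply: contra z0 => /eqP /dot_eq0 ->.
    rewrite mulr0 pmulr_rle0 ?mulr_gt0 ?powR_gt0 // => Kz.
    have K1 : K (v z) = 0 by apply/eqP; rewrite eq_le Kz K0.
    by rewrite /moment2 K1 mulr0; exact: nneseries_ge0.
  move: zr; rewrite inE /square0 /= mulr1 => zr Kz.
  have nz : 0 < `|v z| by rewrite normr_gt0.
  have ex : exists k, rho k.+1 <= `|v z|.
    have e0 : 0 < `|v z| / r0 by rewrite divr_gt0.
    have [k _ /(_ k (leqnn _)) /= kz] := near_infty_natSinv_lt (PosNum e0).
    exists k; rewrite ltr_pdivlMr // mulrC in kz.
    apply: (le_trans _ (ltW kz)); rewrite /rho ler_pM2l //.
    by rewrite lef_pV2 ?posrE ?exprn_gt0 ?ltr0n // -natrX ler_nat; apply: ltnW; exact: ltn_expl.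
  (* The least such k is the index of the annulus that contains v z. *)
  case: (ex_minnP ex) => k kz kmin.
  have zk : `|v z| < rho k.
    case: k kz kmin => [|k] kz kmin; first by rewrite /rho expr0 divr1.
    by rewrite ltNge; apply/negP => /kmin; rewrite ltnn.
  apply: le_trans (nneseries_lim_ge k.+1 (fun n _ _ => h0 n z)).
  rewrite big_nat_recr //=; apply: le_trans (leeDr _ _); last by apply: sume_ge0.
  rewrite /h lee_fin indicE mem_set // mulr1 /c ler_pdivlMr;
    last by rewrite powR_gt0 // exprn_gt0.
  apply: le_trans Kz; rewrite /moment2 mulrAC.
  rewrite ler_wpM2r // ler_wpM2l ?dot_ge0 //.
  apply: ge0_ler_powR; rewrite ?nnegrE ?sqr_ge0 ?dot_ge0 // ?(ltW s_gt0) //.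
  apply: le_trans (sqr_norm_le_dot _).
  by rewrite lerXn2r ?nnegrE // ltW.
apply/integrableP; split => //.
apply: (@le_lt_trans _ _ (\int[mu]_z \sum_(0 <= k <oo) h k z)%E).
  apply: ge0_le_integral => //.
  - exact: measurableT_comp.
  - by apply: ge0_emeasurable_sum.
  - by move=> z _; rewrite /= ger0_norm.
rewrite integral_nneseries //.
rewrite (@eq_eseriesr _ _ (fun k => (geometric (4 * M0 * r0 ^+ 2 / ((r0 ^+ 2) `^ s * b)) q
  k)%:E)); last first.
  move=> k _; rewrite -mass /h.
  under eq_integral do rewrite EFinM.
  rewrite (integralZl measurableT (integrable_square0 (ltW (rho_gt0 k)))).
  rewrite -(fineK (integrable_fin_num measurableT (integrable_square0 (ltW (rho_gt0 k)))))
    -EFinM.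
  by congr (_ * _)%:E; exact: (Rintegral_square0 (ltW (rho_gt0 k))).
have cv : series (geometric (4 * M0 * r0 ^+ 2 / ((r0 ^+ 2) `^ s * b)) q) @ \oo --> (4 * M0
  * r0 ^+ 2 / ((r0 ^+ 2) `^ s * b)) / (1 - q).
  by apply: cvg_geometric_series; rewrite ger0_norm // ltW.
rewrite (cvg_lim _ (_ : _ --> ((4 * M0 * r0 ^+ 2 / ((r0 ^+ 2) `^ s * b)) / (1 - q))%:E))
  ?ltry //.
rewrite (_ : (fun n => _) = EFin \o series (geometric (4 * M0 * r0 ^+ 2 / ((r0 ^+ 2) `^ s *
  b)) q)).
  by apply: cvg_EFin cv; exact: nearW.
by apply/funext => n /=; rewrite sumEFin.
Qed.

End moment_integrability.
End abstract_plane.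

(** * Differential calculus along segments *)

Section calculus.
Variable R : realType.
Implicit Types (u : R * R -> R) (x e : R * R).

Lemma derive_partials u x e : differentiable u x ->
  'D_e u x = e.1 * partial1 u x + e.2 * partial2 u x.
Proof.
move=> du; rewrite /partial1 /partial2 !deriveE //.
have {1}-> : e = e.1 *: ((1, 0) : R * R) + e.2 *: ((0, 1) : R * R).
  case: e => a b; apply/pair_equal_spec; split => /=.
    by rewrite -[a *: 1]/(a * 1) -[b *: 0]/(b * 0) mulr1 mulr0 addr0.
  by rewrite -[a *: 0]/(a * 0) -[b *: 1]/(b * 1) mulr1 mulr0 add0r.
by rewrite linearD !linearZ.
Qed.

(** The mean value theorem along the segment from x to x + e. *)
Lemma segment_mvt u x e : (forall y, differentiable u y) ->
  exists y, u (x + e) - u x = e.1 * partial1 u y + e.2 * partial2 u y.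
Proof.
move=> du; pose g (t : R) := u (x + t *: e).
have Dg (t : R) : is_derive t (1 : R) g ('D_e u (x + t *: e)).
  have E : (fun h : R => h^-1 *: ((g \o shift t) (h *: 1) - g t)) =
      (fun h : R => h^-1 *: ((u \o shift (x + t *: e)) (h *: e) - u (x + t *: e))).
    apply/funext => h; rewrite /g /=; congr (_ *: (u _ - _)).
    by rewrite /shift /= -[h *: 1]/(h * 1) mulr1 scalerDl addrCA.
  have cu := diff_derivable (v := e) (du (x + t *: e)).
  by split; [rewrite /derivable E|rewrite /derive E].
have cg : {within `[0, 1], continuous g}.
  apply: derivable_within_continuous => t _; exact: (@ex_derive _ _ _ _ _ _ _ (Dg t)).
have [t _] := @MVT R g _ 0 1 ltr01 (fun t _ => Dg t) cg.
rewrite /g scale1r scale0r addr0 subr0 mulr1 => ->.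
by exists (x + t *: e); exact: derive_partials.
Qed.

(** Only the steps 1/(n+1) are used, so that limits are taken along a
    sequence, as dominated convergence requires. *)
Lemma quotient_cvg u x e : differentiable u x ->
  (u (x + n.+1%:R^-1 *: e) - u x) / n.+1%:R^-1 @[n --> \oo] --> 'D_e u x.
Proof.
move=> du; have cu := diff_derivable (v := e) du.
have /cvg_dnbhs_at_right/cvg_at_rightP/(_ (fun n => n.+1%:R^-1)) H := cu.
have /H : (forall n : nat, 0 < n.+1%:R^-1 :> R) /\ n.+1%:R^-1 @[n --> \oo] --> (0 : R).
  by split; [move=> n; rewrite invr_gt0|exact: cvg_harmonic].
rewrite -[X in _ --> X]/('D_e u x); apply: cvg_trans.
by apply: near_eq_cvg; near=> n; rewrite /= /shift /= [x + _]addrC mulrC.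
Unshelve. all: by end_near. Qed.

Lemma lipschitz_of_gradient u C : (forall y, differentiable u y) ->
  (forall y, enorm (gradient u y) <= C) -> lipschitz_with (2 * C) u.
Proof.
move=> du uC x y; have [c] := segment_mvt y (x - y) du.
rewrite subrKC => ->.
apply: le_trans (ler_normD _ _) _; rewrite !normrM mulr2n mulrDl mul1r mulrDl.
have gc := le_trans (norm_le_enorm _) (uC c).
by apply: lerD; rewrite mulrC; apply: ler_pM => //;
  [exact: le_trans (norm1_le (gradient u c)) gc|exact: norm1_le
  |exact: le_trans (norm2_le (gradient u c)) gc|exact: norm2_le].
Qed.

Lemma derive_comp (f : R -> R) u x e : differentiable u x -> derivable f (u x) 1 ->
  differentiable (f \o u) x /\ 'D_e (f \o u) x = derive1 f (u x) * 'D_e u x.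
Proof.
move=> du df; have df' : differentiable f (u x) by apply/derivable1_diffP.
have dfu : differentiable (f \o u) x by exact: differentiable_comp.
split => //; rewrite !deriveE // diff_comp // /= derive1E.
rewrite -[X in 'd f _ X]mulr1 -[X in 'd f _ X]/(_ *: 1) linearZ /= mulrC.
by rewrite deriveE.
Qed.

(** On [-C, C] the Hoelder condition bounds f' by its value at 0 plus a
    constant. *)
Lemma C1_hoelder_lipschitz (alpha : R) f C : 0 < alpha -> 0 <= C -> C1_hoelder alpha f ->
  exists2 B, 0 <= B & forall a b, `|a| <= C -> `|b| <= C -> `|f a - f b| <= B * `|a - b|.
Proof.
move=> a0 C0 [df hf]; have [H HC] := hf (- C) C.
exists (`|derive1 f 0| + `|H| * C `^ alpha); first by rewrite addr_ge0 // mulr_ge0 // powR_ge0.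
have fB t : `|t| <= C -> `|derive1 f t| <= `|derive1 f 0| + `|H| * C `^ alpha.
  move=> tC; rewrite -[derive1 f t](subrK (derive1 f 0)) addrC.
  apply: le_trans (ler_normD _ _) _; rewrite lerD2l.
  have := HC t 0; rewrite !in_itv /= -ler_norml tC oppr_le0 C0 => /(_ isT isT) h.
  apply: le_trans h _; apply: le_trans (ler_wpM2r (powR_ge0 _ _) (ler_norm H)) _.
  rewrite ler_wpM2l // ge0_ler_powR ?nnegrE ?subr0 // ltW //.
have cf t : {for t, continuous f}.
  by apply: differentiable_continuous; apply/derivable1_diffP.
have Df (t : R) : is_derive t (1 : R) f (derive1 f t) by rewrite derive1E; exact: derivableP.
have key a b : a < b -> `|a| <= C -> `|b| <= C ->
    `|f b - f a| <= (`|derive1 f 0| + `|H| * C `^ alpha) * `|b - a|.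
  move=> ab aC bC.
  have cab : {within `[a, b], continuous f} by apply: continuous_subspaceT => t; exact: cf.
  have [c + ->] := @MVT R f _ a b ab (fun t _ => Df t) cab.
  rewrite in_itv /= => /andP[ac cb]; rewrite normrM ler_wpM2r // fB //.
  move: aC bC; rewrite !ler_norml => /andP[? ?] /andP[? ?]; apply/andP; split; lra.
move=> a b aC bC; case: (ltgtP a b) => [ab|ab|->].
- by rewrite distrC [`|a - b|]distrC; exact: key.
- exact: key.
- by rewrite !subrr normr0 mulr0.
Qed.

(** The gradient is everywhere proportional to (c, 1), so u is constant
    along the direction (-1, c), in which every x can be moved to the axis
    x.1 = 0. *)
Lemma dot_one_dimensional u c : (forall x, differentiable u x) ->
  (forall x, partial1 u x = c * partial2 u x) -> one_dimensional u.
Proof.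
move=> du cu; exists (fun t => u (0, t)), (c, 1) => x.
(* The displacement that brings the first coordinate to 0. *)
have [y] := segment_mvt x (- x.1, c * x.1) du.
have -> : (- x.1, c * x.1).1 * partial1 u y + (- x.1, c * x.1).2 * partial2 u y = 0.
  by rewrite cu /=; ring.
move=> /subr0_eq <-.
by congr u; case: x => a b; rewrite /dot /=; apply/pair_equal_spec; rewrite subrr mul1r addrC.
Qed.

End calculus.

(** * Consequences of the kernel bounds *)

Section kernel_bounds.
Variable R : realType.
Implicit Types (K : R * R -> R) (z : R * R).

Lemma enorm_le_norm z : enorm z <= 2 * `|z|.
Proof.
have z1 := norm1_le z; have z2 := norm2_le z.
rewrite -[leRHS]ger0_norm ?mulr_ge0 // -sqrtr_sqr /enorm ler_wsqrtr //.
rewrite /dot -!expr2 -(real_normK (num_real z.1)) -(real_normK (num_real z.2)).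
have h1 : `|z.1| ^+ 2 <= `|z| ^+ 2 by rewrite lerXn2r ?nnegrE.
have h2 : `|z.2| ^+ 2 <= `|z| ^+ 2 by rewrite lerXn2r ?nnegrE.
have h3 : 0 <= `|z| ^+ 2 by exact: sqr_ge0.
apply: le_trans (lerD h1 h2) _; rewrite exprMn -natrX; move: h3; set p := `|z| ^+ 2; lra.
Qed.

Lemma enorm_gt0 z : z != 0 -> 0 < enorm z.
Proof.
move=> z0; rewrite /enorm sqrtr_gt0 lt0r dot_ge0 andbT.
by apply: contra z0 => /eqP /dot_eq0 ->.
Qed.

Lemma powR_enorm z s : z != 0 -> enorm z `^ (2 + 2 * s) = dot z z * dot z z `^ s.
Proof.
move=> /enorm_gt0 z0; rewrite powRD; last by apply/implyP => _; rewrite gt_eqF.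
have e2 : enorm z `^ 2 = dot z z by rewrite powR_mulrn ?(ltW z0) // sqr_enorm.
by rewrite powRrM e2.
Qed.

Lemma indic_eballN r z : \1_(eball 0 r) (- z) = \1_(eball 0 r) z :> R.
Proof.
rewrite !indicE; suff -> : (- z \in eball 0 r) = (z \in eball 0 r) by [].
by apply/idP/idP; rewrite !inE /eball /= !subr0 enormN.
Qed.

Lemma indic_eball_le_square0 r z : \1_(eball 0 r) z <= \1_(square0 r) z :> R.
Proof.
rewrite !indicE; have [zr|_] := boolP (z \in eball 0 r); last by case: (_ \in _).
rewrite mem_set //; move: zr; rewrite inE /eball /square0 /= subr0.
exact: le_lt_trans (norm_le_enorm z).
Qed.

Lemma indic_square0_out r z : r <= `|z| -> \1_(square0 r) z = 0 :> R.
Proof. by move=> rz; rewrite indicE memNset //= /square0 /= ltNge rz. Qed.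

Lemma indic_eball_in r z : `|z| < r / 2 -> \1_(eball 0 r) z = 1 :> R.
Proof.
move=> zr; rewrite indicE mem_set //= /eball /= subr0.
by apply: le_lt_trans (enorm_le_norm z) _; rewrite mulrC -ltr_pdivlMr.
Qed.

Lemma bounded_kernel_symm m0 M0 r0 R0 K :
  bounded_kernel m0 M0 r0 R0 K -> bounded_kernel m0 M0 r0 R0 (symm K).
Proof.
by move=> HK z; apply: symm_between => //; have := HK (- z); rewrite !indic_eballN.
Qed.

Lemma fractional_kernel_symm m0 M0 r0 R0 s K :
  fractional_kernel m0 M0 r0 R0 s K -> fractional_kernel m0 M0 r0 R0 s (symm K).
Proof.
move=> HK z z0; have Nz0 : - z != 0 by rewrite oppr_eq0.
have := HK _ Nz0; have := HK _ z0; rewrite !indic_eballN enormN /symm.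
by move=> /andP[? ?] /andP[? ?]; apply/andP; split; lra.
Qed.

Lemma bounded_kernel_upper m0 M0 r0 R0 K : 0 <= M0 -> bounded_kernel m0 M0 r0 R0 K ->
  forall z, K z <= M0 * \1_(square0 R0) z.
Proof.
move=> M0_ge0 HK z; have /andP[_ h] := HK z.
by apply: le_trans h _; rewrite ler_wpM2l // indic_eball_le_square0.
Qed.

Lemma fractional_kernel_upper m0 M0 r0 R0 s K : 0 <= M0 -> fractional_kernel m0 M0 r0 R0 s K ->
  forall z, z != 0 -> dot z z * dot z z `^ s * K z <= M0 * \1_(square0 R0) z.
Proof.
move=> M0_ge0 HK z z0; have /andP[_ h] := HK z z0.
by rewrite -powR_enorm //; apply: le_trans h _; rewrite ler_wpM2l // indic_eball_le_square0.
Qed.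

Lemma bounded_kernel_support m0 M0 r0 R0 K : (forall z, 0 <= K z) -> 0 <= M0 ->
  bounded_kernel m0 M0 r0 R0 K -> forall z, R0 <= `|z| -> K z = 0.
Proof.
move=> K0 M0_ge0 HK z zR; have := bounded_kernel_upper M0_ge0 HK z.
by rewrite indic_square0_out // mulr0 => h; apply/eqP; rewrite eq_le h K0.
Qed.

Lemma fractional_kernel_support m0 M0 r0 R0 s K : (forall z, 0 <= K z) -> 0 <= M0 -> 0 < R0 ->
  fractional_kernel m0 M0 r0 R0 s K -> forall z, R0 <= `|z| -> K z = 0.
Proof.
move=> K0 M0_ge0 R0_gt0 HK z zR.
have z0 : z != 0 by rewrite -normr_gt0 (lt_le_trans R0_gt0).
have := fractional_kernel_upper M0_ge0 HK z0.
have D0 : 0 < dot z z by rewrite -sqr_enorm exprn_gt0 // enorm_gt0.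
rewrite indic_square0_out // mulr0 pmulr_rle0 ?mulr_gt0 ?powR_gt0 // => h.
by apply/eqP; rewrite eq_le h K0.
Qed.

Lemma bounded_kernel_lower m0 M0 r0 R0 K : bounded_kernel m0 M0 r0 R0 K ->
  forall z, `|z| < r0 / 2 -> m0 <= K z.
Proof. by move=> HK z zr; have /andP[+ _] := HK z; rewrite indic_eball_in // mulr1. Qed.

Lemma fractional_kernel_lower m0 M0 r0 R0 s K : (forall z, 0 <= K z) -> 0 < r0 -> 0 < s ->
  fractional_kernel m0 M0 r0 R0 s K ->
  forall z, z != 0 -> `|z| < r0 / 2 -> m0 / r0 `^ (2 + 2 * s) <= K z.
Proof.
move=> K0 r0_gt0 s0 HK z z0 zr; have /andP[+ _] := HK z z0.
rewrite indic_eball_in // mulr1 => h; rewrite ler_pdivrMr ?powR_gt0 // mulrC.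
apply: le_trans h _; rewrite ler_wpM2r // ge0_ler_powR ?nnegrE ?sqrtr_ge0 ?(ltW r0_gt0) //.
  by rewrite addr_ge0 // mulr_ge0 // ltW.
apply: (le_trans (enorm_le_norm z)).
by rewrite mulrC -ler_pdivlMr // ltW.
Qed.

End kernel_bounds.

(** * One-dimensionality *)

Section nonlocal.
Context (R : realType) d (P : measurableType d)
  (mu : {sigma_finite_measure set P -> \bar R}) (v : P -> R * R).
Hypotheses (mv : measurable_fun setT (v : P -> (measurableTypeR R * measurableTypeR R)%type))
  (aff_meas : forall s a (g : R * R -> \bar R), measurable_fun setT (g \o v) ->
     measurable_fun setT ((g \o aff s a) \o v))
  (aff_int : forall s a (g : R * R -> \bar R), measurable_fun setT (g \o v) ->
     (\int[mu]_x g (aff s a (v x)) = \int[mu]_x g (v x))%E)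
  (mu_box : forall a b c e : R, a <= b -> c <= e ->
     mu (v @^-1` (`]a, b[%classic `*` `]c, e[%classic)) = ((b - a) * (e - c))%:E).

(** What the two alternatives on K have in common: bounded support, a
    positive lower bound near the origin, and a finite second moment. In the
    second alternative the lower bound is m0 r0^-(2+2s), as |z|^(2+2s) is
    largest on the boundary of the ball. The radius r0 / 2 makes room for
    the passage from the Euclidean to the sup norm. *)
Lemma kernel_reduction (K : R * R -> R) (m0 M0 r0 R0 : R) :
  (forall z, 0 <= K z) -> measurable_fun setT (K \o v) ->
  0 < m0 -> m0 <= M0 -> 0 < r0 -> r0 <= R0 ->
  bounded_kernel m0 M0 r0 R0 K \/
    (exists s : R, 0 < s < 1 /\ fractional_kernel m0 M0 r0 R0 s K) ->
  [/\ forall z, R0 <= `|z| -> symm K z = 0,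
      exists2 m1, 0 < m1 & forall z, z != 0 -> `|z| < r0 / 2 -> m1 <= symm K z
    & mu.-integrable setT (EFin \o moment2 (symm K) \o v)].
Proof.
move=> K0 mK m0_gt0 mM r0_gt0 rR HK.
have S0 z : 0 <= symm K z by rewrite /symm divr_ge0 // addr_ge0.
have mS := measurable_symm aff_meas mK.
have R0_gt0 := lt_le_trans r0_gt0 rR.
have M0_ge0 := ltW (lt_le_trans m0_gt0 mM).
case: HK => [/bounded_kernel_symm HS|[s [s01 /fractional_kernel_symm HS]]].
  split; first exact: bounded_kernel_support HS.
    by exists m0 => // z _; exact: (bounded_kernel_lower HS).
  exact: (integrable_moment2_bounded mv mu_box mS S0 R0_gt0 (bounded_kernel_upper M0_ge0 HS)).
have /andP[s0 _] := s01; split; first exact: fractional_kernel_support HS.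
  exists (m0 / r0 `^ (2 + 2 * s)); first by rewrite divr_gt0 // powR_gt0.
  exact: fractional_kernel_lower HS.
exact: (integrable_moment2_fractional mv mu_box mS S0 R0_gt0 M0_ge0 s01
  (fractional_kernel_upper M0_ge0 HS)).
Qed.

(** The difference quotients of f o u converge to f'(u) times the partial
    derivatives of u, so their limits Gphi and Gpsi satisfy the
    proportionality that [gradient_direction] asks for. *)
Lemma nonlocal_one_dimensional (K : R * R -> R) (m0 M0 r0 R0 alpha : R) (f : R ->
  R) (u : R * R -> R) :
  (forall z, 0 <= K z) -> measurable_fun setT (K \o v) ->
  {ae mu, forall z, K (v z) = K (- v z)} ->
  0 < m0 -> m0 <= M0 -> 0 < r0 -> r0 <= R0 ->
  bounded_kernel m0 M0 r0 R0 K \/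
    (exists s : R, 0 < s < 1 /\ fractional_kernel m0 M0 r0 R0 s K) ->
  0 < alpha -> C1_hoelder alpha f -> C1 u ->
  (exists C, forall x, `|u x| <= C) ->
  (exists C, forall x, enorm (gradient u x) <= C) ->
  (forall x,
    (mu.-integrable setT (EFin \o (fun y => nonlocal_integrand K u x (v y))) /\
     (\int[mu]_y (nonlocal_integrand K u x (v y))%:E)%E = (f (u x))%:E) \/
    (\int[mu]_(y in ~` (v @^-1` eball x r)) (nonlocal_integrand K u x (v y))%:E)%E
      @[r --> 0^'+] --> (f (u x))%:E) ->
  (forall x, 0 < partial2 u x) -> one_dimensional u.
Proof.
move=> K0 mK Kae m0_gt0 mM r0_gt0 rR HK a0 hf [du cu] [C uC] [Cg gC] Hu u2.
have [supp [m1 m1_gt0 low] ik] := kernel_reduction K0 mK m0_gt0 mM r0_gt0 rR HK.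
have S0 z : 0 <= symm K z by rewrite /symm divr_ge0 // addr_ge0.
have mS := measurable_symm aff_meas mK.
have R0_gt0 := lt_le_trans r0_gt0 rR.
have C0 : 0 <= C by exact: le_trans (uC 0).
have Cg0 : 0 <= Cg by apply: le_trans (gC 0); exact: sqrtr_ge0.
have uL := lipschitz_of_gradient du gC.
have L0 : 0 <= 2 * Cg by rewrite mulr_ge0.
have [B B0 fB] := C1_hoelder_lipschitz a0 C0 hf.
have cuu : continuous u by exact: lipschitz_continuous uL.
have FL : lipschitz_with (B * (2 * Cg)) (f \o u).
  by move=> x y; apply: le_trans (fB _ _ (uC x) (uC y)) _; rewrite -mulrA ler_wpM2l.
have pv : pv_solution mu v (symm K) u (f \o u).
  move=> x; have iL n := integrable_Ltrunc mv S0 mS ik n x cuu uC.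
  case: (Hu x) => [[ig gl]|H].
    exact: (pv_of_integral_value mv aff_int mK Kae cuu iL ig gl).
  exact: (pv_of_principal_value mv aff_int mK Kae cuu iL H).
have df : forall t, derivable f t 1 by case: hf.
have dfu x : differentiable (f \o u) x by have [] := derive_comp 0 (du x) (df (u x)).
have Dfu x e : 'D_e (f \o u) x = derive1 f (u x) * 'D_e u x.
  by have [] := derive_comp e (du x) (df (u x)).
pose h n : R := n.+1%:R^-1.
have h0 n : 0 < h n by rewrite invr_gt0.
have e1 n : (h n, 0) = h n *: ((1, 0) : R * R).
  by apply/pair_equal_spec; split;
    rewrite /= -?[_ *: 1]/(_ * 1) -?[_ *: 0]/(_ * 0) ?mulr1 ?mulr0.
have e2 n : (0, h n) = h n *: ((0, 1) : R * R).
  by apply/pair_equal_spec; split;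
    rewrite /= -?[_ *: 1]/(_ * 1) -?[_ *: 0]/(_ * 0) ?mulr1 ?mulr0.
have incr n x : u x < u (x + (0, h n)).
  have [y] := segment_mvt x (0, h n) du.
  by rewrite -subr_gt0 => ->; rewrite /= mul0r add0r mulr_gt0.
have lim1 (g : R * R -> R) x : differentiable g x ->
  (g (x + (h n, 0)) - g x) / h n @[n --> \oo] --> partial1 g x.
  by move=> dg; under eq_fun do rewrite e1; exact: quotient_cvg.
have lim2 (g : R * R -> R) x : differentiable g x ->
  (g (x + (0, h n)) - g x) / h n @[n --> \oo] --> partial2 g x.
  by move=> dg; under eq_fun do rewrite e2; exact: quotient_cvg.
have c1 : continuous (partial1 u).
  by move=> x; apply: (@continuous_comp _ _ _ (gradient u) fst); [exact: cu|exact: cvg_fst].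
have c2 : continuous (partial2 u).
  by move=> x; apply: (@continuous_comp _ _ _ (gradient u) snd); [exact: cu|exact: cvg_snd].
have r2 : 0 < r0 / 2 by rewrite divr_gt0.
have LF0 : 0 <= B * (2 * Cg) by rewrite mulr_ge0.
have G0 x : partial1 (f \o u) x * partial2 u x = partial2 (f \o u) x * partial1 u x.
  by rewrite /partial1 /partial2 !Dfu mulrAC.
have [c uc] := gradient_direction mv aff_int mu_box S0 mS (symm_even K) R0_gt0 supp ik
  L0 LF0 m1_gt0 r2 low uL uC FL pv incr
  (fun x => lim2 u x (du x)) (fun x => lim1 u x (du x))
  (fun x => lim2 _ x (dfu x)) (fun x => lim1 _ x (dfu x)) G0 c2 c1 u2.
exact: dot_one_dimensional du uc.
Qed.

End nonlocal.

Unset Implicit Arguments.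

Theorem theorem1p2 (R : realType) (K : R * R -> R) (m0 M0 r0 R0 alpha : R)
    (f : R -> R) (u : R * R -> R)
    (K_ge0 : forall z : R * R, 0 <= K z)
    (K_meas : lebesgue_measurable_fun K)
    (K_even : even_ae K)
    (hm0 : 0 < m0) (hM0 : m0 <= M0) (hr0 : 0 < r0) (hR0 : r0 <= R0)
    (K_bounds : bounded_kernel m0 M0 r0 R0 K \/
      exists s : R, 0 < s < 1 /\ fractional_kernel m0 M0 r0 R0 s K)
    (halpha : 0 < alpha < 1) (hf : C1_hoelder alpha f)
    (u_C1 : C1 u)
    (u_bounded : exists C : R, forall x : R * R, `|u x| <= C)
    (grad_u_bounded : exists C : R, forall x : R * R, enorm (gradient u x) <= C)
    (u_solution : nonlocal_solution K f u)
    (u_monotone : forall x : R * R, 0 < partial2 u x) :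
  one_dimensional u.
Proof.
have /andP[alpha0 _] := halpha.
pose v : plane R -> R * R := id.
have aff_meas s a (g : R * R -> \bar R) : measurable_fun setT (g \o v) ->
    measurable_fun setT ((g \o aff s a) \o v).
  by move=> mg; exact: (measurableT_comp mg (measurable_plane_aff s a)).
apply: (@nonlocal_one_dimensional R _ (plane R) (lebesgue2_sf R) v (measurable_plane_bplane
  (R := R))
  aff_meas (@integral_aff R) (@lebesgue2_box R) K m0 M0 r0 R0 alpha f u) => //.
move=> x; have := u_solution x; rewrite /nonlocal_value.
by case: ifP => _ [H1 H2]; [left; split|right].
Qed.
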